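(* Let $M=\Omega/\Gamma$ be a strictly convex real projective $n$-manifold that contains a maximal cusp $B$, and let $p\in\mathcal L$ be a point in the (positive) lightcone $\mathcal L\subset\mathbb R^{n+1}$ of $\Omega$ such that $\mathbb P(p)\in\partial\Omega$ is the parabolic fixed point of $\pi_1B$. Then the $\Gamma$-orbit $\Gamma p=\{\gamma p:\gamma\in\Gamma\}$ is a discrete subset of $\mathbb R^{n+1}$.
   Context: $\mathbb P:\mathbb R^{n+1}\setminus 0\to\mathbb{RP}^n$ is projectivization. A subset $\Omega\subset\mathbb{RP}^n$ is properly convex if it is the (nonempty) interior of a compact convex set $K$ that is disjoint from some codimension-1 projective hyperplane, and strictly convex if in addition $K$ contains no line segment of positive length in its boundary. A strictly convex real projective $n$-manifold is $M=\Omega/\Gamma$ where $\Omega\subset\mathbb{RP}^n$ is strictly convex and $\Gamma\cong\pi_1M$ is a discrete group of projective transformations that preserves $\Omega$ and acts freely on it. Identify $\Omega$ with a subset of an affine hyperplane in $\mathbb R^{n+1}$ (not through $0$). Then $\mathcal C\Omega=\mathbb R_{>0}\cdot\Omega\subset\mathbb R^{n+1}$ is an open convex cone based at $0$ with $\mathbb P(\mathcal C\Omega)=\Omega$. The (positive) lightcone of $\Omega$ is $\mathcal L=\mathcal C(\partial\Omega)=\mathbb R_{>0}\cdot\partial\Omega$, i.e. the frontier of $\mathcal C\Omega$ with $0$ deleted. Throughout, $\Gamma$ is lifted to a subgroup of $SL(\Omega)$, the group of matrices of determinant $\pm1$ that preserve $\Omega$ (acting on $\mathbb R^{n+1}$ and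 preserving the cone $\mathcal C\Omega$). An element of $SL(\Omega)$ is parabolic if all its eigenvalues have modulus $1$ and it is not semisimple. A maximal cusp in $M=\Omega/\Gamma$ is a connected (codimension-0) submanifold $B$ such that $\partial B=\overline{M\setminus B}\cap B$ is compact and: (C1) every component $\tilde B$ of the pre-image of $B$ in $\Omega$ has strictly convex interior; (C2) $cl(\tilde B)\cap\partial\Omega$ is a single point $p_{\tilde B}$, called a parabolic fixed point; (C3) the stabilizer $\Gamma_{\tilde B}\subset\Gamma$ of $\tilde B$ fixes $p_{\tilde B}$; (C4) there is a unique projective hyperplane $H\subset\mathbb{RP}^n$ with $p_{\tilde B}=H\cap\overline\Omega$; (C5) every non-trivial element of $\Gamma_{\tilde B}$ is parabolic and preserves $H$; (C6) $\Gamma_{\tilde B}$ is conjugate into $PO(n,1)$, so contains $\mathbb Z^{n-1}$ as a subgroup of finite index. The group $\pi_1B$ is identified with $\Gamma_{\tilde B}$ for a choice of component $\tilde B$, and its parabolic fixed point is $p_{\tilde B}$. *)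

(* Defs.v *)
From HB Require Import structures.
From mathcomp Require Import all_boot all_order all_algebra.
From mathcomp Require Import all_classical all_reals all_analysis.
From mathcomp Require Import complex.

Set Implicit Arguments.
Unset Strict Implicit.
Unset Printing Implicit Defensive.

Import Order.TTheory GRing.Theory Num.Theory.
Import numFieldNormedType.Exports.

Local Open Scope classical_set_scope.
Local Open Scope ring_scope.
Local Open Scope quotient_scope.

Section Topology.
Context {T : topologicalType}.

Definition frontier (A : set T) : set T := closure A `\` A°.

(* The subspace topology on A is discrete. *)
Definition discrete_subset (A : set T) : Prop := A `<=` isolated A.

Definition is_component (A C : set T) : Prop :=
  exists2 x, A x & C = connected_component A x.

Definition halfspace (R : realType) (n : nat) : set 'cV[R]_n :=
  [set y | forall i : 'I_n, i = 0%N :> nat -> 0 <= y i 0].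

(* B, with the subspace topology, is a topological n-manifold with boundary:
   it is locally homeomorphic to open subsets of the half-space x_0 >= 0
   (which is the whole of R^0 when n = 0). *)
Definition codim0_submanifold (R : realType) (n : nat) (B : set T) : Prop :=
  forall x, B x -> exists U : set T, exists V : set 'cV[R]_n,
    exists f : T -> 'cV[R]_n, exists g : 'cV[R]_n -> T,
    let U' := U `&` B in
    let V' := V `&` @halfspace R n in
    [/\ open U /\ U x, open V,
        f @` U' = V' /\ g @` V' = U',
        (forall y, U' y -> g (f y) = y) /\ (forall z, V' z -> f (g z) = z)
      & {within U', continuous f} /\ {within V', continuous g}].

End Topology.

Section ProjectiveSpace.
Context {R : realType} {n : nat}.

Definition nonzero : set 'cV[R]_n.+1 := [set v | v != 0].

Definition collinear (u v : nonzero) : bool :=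
  `[< exists2 c : R, c != 0 & \val u = c *: \val v >].

Lemma collinear_refl : reflexive collinear.
Proof. by move=> u; apply/asboolP; exists 1; rewrite ?oner_neq0 ?scale1r. Qed.

Lemma collinear_sym : symmetric collinear.
Proof.
suff H u v : collinear u v -> collinear v u by move=> u v; apply/idP/idP; exact: H.
move=> /asboolP[c c0 uv]; apply/asboolP; exists c^-1; first by rewrite invr_neq0.
by rewrite uv scalerA mulVf// scale1r.
Qed.

Lemma collinear_trans : transitive collinear.
Proof.
move=> v u w /asboolP[c c0 uv] /asboolP[d d0 vw]; apply/asboolP.
by exists (c * d); rewrite ?mulf_neq0// uv vw scalerA.
Qed.

Canonical collinear_equiv :=
  EquivRel collinear collinear_refl collinear_sym collinear_trans.

End ProjectiveSpace.

Definition RP (R : realType) (n : nat) : Type :=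
  quotient_topology {eq_quot (@collinear_equiv R n)}.

Section ProjectiveGeometry.
Context {R : realType} {n : nat}.

Lemma const1_nonzero : (const_mx 1 : 'cV[R]_n.+1) \in nonzero.
Proof.
rewrite inE /nonzero /=; apply/eqP => /matrixP/(_ 0 0)/eqP.
by rewrite !mxE oner_eq0.
Qed.

(* Projectivization; the value at 0 is irrelevant. *)
Definition projectivize (v : 'cV[R]_n.+1) : RP R n :=
  \pi_(RP R n) (insubd (exist (fun v => v \in nonzero) _ const1_nonzero) v).

Definition homog (x : RP R n) : 'cV[R]_n.+1 := \val (repr x).

(* Meaningful for invertible A. *)
Definition pact (A : 'M[R]_n.+1) (x : RP R n) : RP R n :=
  projectivize (A *m homog x).

Definition linform (phi : 'rV[R]_n.+1) (v : 'cV[R]_n.+1) : R := (phi *m v) 0 0.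

Definition hyperplane (phi : 'rV[R]_n.+1) : set (RP R n) :=
  projectivize @` [set v | v != 0 /\ linform phi v = 0].

Definition is_hyperplane (H : set (RP R n)) : Prop :=
  exists2 phi, phi != 0 & H = hyperplane phi.

(* The part of A off the hyperplane [phi = 0], seen in the affine hyperplane
   [phi = 1] of R^(n+1). *)
Definition chart (phi : 'rV[R]_n.+1) (A : set (RP R n)) : set 'cV[R]_n.+1 :=
  [set v | linform phi v = 1 /\ A (projectivize v)].

Definition segment (u v : 'cV[R]_n.+1) : set 'cV[R]_n.+1 :=
  [set (1 - t) *: u + t *: v | t in [set t : R | 0 <= t <= 1]].

Definition compact_convex (phi : 'rV[R]_n.+1) (K : set (RP R n)) : Prop :=
  [/\ phi != 0, compact K, K `&` hyperplane phi = set0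
    & convex_set (chart phi K)].

Definition strictly_convex (Omega : set (RP R n)) : Prop :=
  Omega !=set0 /\
  exists phi K, [/\ compact_convex phi K, Omega = K°
    & forall u v, chart phi K u -> chart phi K v -> u != v ->
        ~ (projectivize @` segment u v `<=` frontier K)].

(* The cone R_{>0}.A over A, identified with its image in [phi = 1]. *)
Definition cone (phi : 'rV[R]_n.+1) (A : set (RP R n)) : set 'cV[R]_n.+1 :=
  [set w | exists t v, [/\ 0 < t, chart phi A v & w = t *: v]].

Definition lightcone (phi : 'rV[R]_n.+1) (Omega : set (RP R n)) :=
  cone phi (frontier Omega).

Definition SL (phi : 'rV[R]_n.+1) (Omega : set (RP R n)) : set 'M[R]_n.+1 :=
  [set A | [/\ \det A = 1 \/ \det A = -1,
               pact A @` Omega = Omega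
             & mulmx A @` cone phi Omega = cone phi Omega]].

Definition is_subgroup (G : set 'M[R]_n.+1) : Prop :=
  [/\ G `<=` [set A | A \in unitmx], G 1%:M,
      (forall A B, G A -> G B -> G (A *m B))
    & forall A, G A -> G (invmx A)].

Definition acts_freely (G : set 'M[R]_n.+1) (X : set (RP R n)) : Prop :=
  forall A x, G A -> X x -> pact A x = x -> A = 1%:M.

(* Semisimple: diagonalizable over the complex numbers. *)
Definition semisimple (A : 'M[R]_n.+1) : Prop :=
  diagonalizable (map_mx (real_complex R) A).

Definition parabolic (A : 'M[R]_n.+1) : Prop :=
  (forall z : R[i], eigenvalue (map_mx (real_complex R) A) z -> `|z| = 1) /\
  ~ semisimple A.

Definition lorentz : 'M[R]_n.+1 :=
  diag_mx (\row_(i < n.+1) (if i == ord_max then -1 else 1)).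

Definition O_n1 : set 'M[R]_n.+1 := [set X | X^T *m lorentz *m X = lorentz].

(* Conjugacy in PGL(n+1, R), hence the scalar c. *)
Definition conjugate_into_PO (G : set 'M[R]_n.+1) : Prop :=
  exists2 g : 'M[R]_n.+1, g \in unitmx &
    forall A, G A -> exists2 c : R, c != 0 & O_n1 (c *: (g *m A *m invmx g)).

(* G contains Z^k as a subgroup of finite index. *)
Definition virtually_Zk (k : nat) (G : set 'M[R]_n.+1) : Prop :=
  exists h : 'rV[int]_k -> 'M[R]_n.+1,
    [/\ forall a, G (h a), injective h,
        forall a b, h (a + b) = h a *m h b
      & exists2 F : set 'M[R]_n.+1, finite_set F &
          forall A, G A -> exists f a, F f /\ A = f *m h a].

End ProjectiveGeometry.

Section QuotientManifold.
Context {R : realType} {n : nat}.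
Variables (Omega : set (RP R n)) (Gamma : set 'M[R]_n.+1).

Definition proj_orbit (x : RP R n) : set (RP R n) := [set pact A x | A in Gamma].

(* Equality of orbits is an equivalence relation for any set Gamma, and it is
   the orbit relation when Gamma is a group. *)
Definition same_orbit (x y : Omega) : bool :=
  `[< proj_orbit (\val x) = proj_orbit (\val y) >].

Lemma same_orbit_refl : reflexive same_orbit.
Proof. by move=> x; apply/asboolP. Qed.

Lemma same_orbit_sym : symmetric same_orbit.
Proof. by move=> x y; apply/asboolP/asboolP => ->. Qed.

Lemma same_orbit_trans : transitive same_orbit.
Proof. by move=> y x z /asboolP xy /asboolP yz; apply/asboolP; rewrite xy. Qed.

Canonical same_orbit_equiv :=
  EquivRel same_orbit same_orbit_refl same_orbit_sym same_orbit_trans.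

Definition orbit_space : Type := quotient_topology {eq_quot same_orbit_equiv}.

(* The preimage of B in Omega, as a subset of projective space. *)
Definition cover_preimage (B : set orbit_space) : set (RP R n) :=
  [set \val x | x in [set x : Omega | B (\pi_orbit_space x)]].

Definition stabilizer (Bt : set (RP R n)) : set 'M[R]_n.+1 :=
  [set A | Gamma A /\ pact A @` Bt = Bt].

Definition parabolic_fixed_point (Bt : set (RP R n)) (q : RP R n) : Prop :=
  closure Bt `&` frontier Omega = [set q].

Definition supporting_hyperplane (q : RP R n) (H : set (RP R n)) : Prop :=
  is_hyperplane H /\ H `&` closure Omega = [set q].

Definition cusp_component (Bt : set (RP R n)) : Prop :=
  strictly_convex Bt° /\
  exists q H,
    [/\ parabolic_fixed_point Bt q,
        forall A, stabilizer Bt A -> pact A q = q,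
        supporting_hyperplane q H /\
          (forall H', supporting_hyperplane q H' -> H' = H),
        forall A, stabilizer Bt A -> A <> 1%:M ->
          parabolic A /\ pact A @` H = H
      & conjugate_into_PO (stabilizer Bt) /\
          virtually_Zk n.-1 (stabilizer Bt)].

Definition maximal_cusp (B : set orbit_space) : Prop :=
  [/\ connected B, codim0_submanifold R n B, compact (closure (~` B) `&` B)
    & forall Bt, is_component (cover_preimage B) Bt -> cusp_component Bt].

End QuotientManifold.

(* Omega/Gamma is a strictly convex real projective manifold.  The holonomy
   group is given by its lift to SL(Omega); the affine hyperplane [phi = 1] is
   one in which the closure of Omega lies. *)
Definition strictly_convex_manifold (R : realType) (n : nat)
    (phi : 'rV[R]_n.+1) (Omega : set (RP R n)) (Gamma : set 'M[R]_n.+1) : Prop :=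
  [/\ strictly_convex Omega,
      phi != 0 /\ closure Omega `&` hyperplane phi = set0,
      is_subgroup Gamma /\ Gamma `<=` SL phi Omega,
      discrete_subset Gamma
    & acts_freely Gamma Omega].

(* Main.v *)
(** Let C be the cone over Omega, S the stabilizer of the component Bt, D the cone
    over the interior of Bt, and psi a functional that defines the supporting
    hyperplane at p and is positive on C.  The group S fixes both p and psi, and D,
    which is stable under adding positive multiples of p, plays the role of a horoball.
    The heart of the matter is that psi (A p) is bounded below over all A in Gamma
    with A p <> p; as psi p = 0, this isolates p in its orbit.

    S preserves a Lorentz form for which p is null, so it acts on [psi = 1] modulo p,
    a Euclidean space of dimension n - 1, by isometries.  It is discrete and contains
    Z^(n-1), hence acts cocompactly by an elementary form of Bieberbach's theorem.
    Consequently D lies over all of [psi = 1], and S moves every point of [psi = 1]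
    over a fixed compact set.

    Suppose that psi (A p) is tiny.  Moving A p by S, we get F in Gamma with F p
    tiny.  Fix x in D.  Since F does not stabilize Bt, F^-1 x is not in D; so, after
    moving it by S and rescaling it by l, it lies below a compact set K of points of
    D: for some E in Gamma with E p = F p we have x + t F p = l E k with k in K and
    t = O(l).  Comparing in the order defined by C, the norm of E^-1 is O(l), and
    E^-1 sends the tiny vector F p to p, so l is huge; then E k is tiny, hence E is
    tiny, contradicting det E = +-1. *)

Require Import Defs.
From HB Require Import structures.
From mathcomp Require Import all_boot all_order all_algebra.
From mathcomp Require Import all_classical all_reals all_analysis.
From mathcomp Require Import perm complex.
From mathcomp Require Import ring lra.

Set Implicit Arguments.
Unset Strict Implicit.
Unset Printing Implicit Defensive.

Import Order.TTheory GRing.Theory Num.Theory.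
Import numFieldNormedType.Exports.

Local Open Scope classical_set_scope.
Local Open Scope ring_scope.

(** * Norms of matrices and linear forms *)

Section MatrixNorm.
Context {R : realType}.

Lemma mx_entry_le m n (M : 'M[R]_(m, n)) i j : `|M i j| <= `|M|.
Proof.
rewrite [leRHS]/Num.norm /= mx_normrE.
by apply/bigmax_geP; right => /=; exists (i, j).
Qed.

Lemma mx_norm_le m n (M : 'M[R]_(m, n)) r :
  0 <= r -> (forall i j, `|M i j| <= r) -> `|M| <= r.
Proof.
move=> r0 H; rewrite [leLHS]/Num.norm /= mx_normrE.
by apply/bigmax_leP; split => // -[i j] _ /=.
Qed.

Lemma mx_norm_mul m n k (A : 'M[R]_(m, n)) (B : 'M[R]_(n, k)) :
  `|A *m B| <= n%:R * `|A| * `|B|.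
Proof.
apply: mx_norm_le => [|i j]; first by rewrite !mulr_ge0.
rewrite mxE (le_trans (ler_norm_sum _ _ _))//.
rewrite -mulrA mulr_natl -[X in _ *+ X]card_ord -sumr_const.
by apply: ler_sum => l _; rewrite normrM ler_pM// mx_entry_le.
Qed.

Lemma mx_norm_tr m n (A : 'M[R]_(m, n)) : `|A^T| = `|A|.
Proof.
suff H k l (M : 'M[R]_(k, l)) : `|M^T| <= `|M|.
  by apply/eqP; rewrite eq_le H -{1}(trmxK A) H.
by apply: mx_norm_le => // i j; rewrite mxE mx_entry_le.
Qed.

(** The norm is the largest absolute value of an entry, and each entry appears in the image of a
    basis vector, which has norm at most 1. *)
Lemma mx_norm_le_col m n (A : 'M[R]_(m, n)) r :
  0 <= r -> (forall u : 'cV_n, `|u| <= 1 -> `|A *m u| <= r) -> `|A| <= r.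
Proof.
move=> r0 H; apply: mx_norm_le => // i j.
have -> : A i j = (A *m delta_mx j 0 : 'cV_m) i 0 by rewrite -colE mxE.
apply: (le_trans (mx_entry_le _ _ _)); apply: H.
apply: mx_norm_le => // k l; rewrite mxE.
by case: (_ && _); rewrite ?normr1 ?normr0.
Qed.

(** Leibniz expansion, term by term. It serves to show that a matrix of determinant +-1 cannot be
    tiny. *)
Lemma det_norm_le n (A : 'M[R]_n) : `|\det A| <= (n`!)%:R * `|A| ^+ n.
Proof.
rewrite /determinant (le_trans (ler_norm_sum _ _ _))//.
have -> : (n`!)%:R * `|A| ^+ n = \sum_(s : 'S_n) `|A| ^+ n.
  rewrite sumr_const mulr_natl; congr (_ *+ _).
  by rewrite -card_Sn; apply: eq_card => s; rewrite !inE.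
apply: ler_sum => s _; rewrite normrM normrX normrN1 expr1n mul1r normr_prod.
rewrite -[X in _ ^+ X]card_ord -prodr_const.
by apply: ler_prod => i _; rewrite normr_ge0 mx_entry_le.
Qed.

End MatrixNorm.

Section Linform.
Context {R : realType} {n : nat}.
Implicit Types (phi chi : 'rV[R]_n.+1) (u v : 'cV[R]_n.+1).

Lemma linformD phi u v : linform phi (u + v) = linform phi u + linform phi v.
Proof. by rewrite /linform mulmxDr mxE. Qed.

Lemma linformZ phi (t : R) v : linform phi (t *: v) = t * linform phi v.
Proof. by rewrite /linform -scalemxAr mxE. Qed.

Lemma linformN phi v : linform phi (- v) = - linform phi v.
Proof. by rewrite /linform mulmxN mxE. Qed.

Lemma linformB phi u v : linform phi (u - v) = linform phi u - linform phi v.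
Proof. by rewrite linformD linformN. Qed.

Lemma linformDl phi chi v : linform (phi + chi) v = linform phi v + linform chi v.
Proof. by rewrite /linform mulmxDl mxE. Qed.

Lemma linformNl phi v : linform (- phi) v = - linform phi v.
Proof. by rewrite /linform mulNmx mxE. Qed.

Lemma linformZl phi (t : R) v : linform (t *: phi) v = t * linform phi v.
Proof. by rewrite /linform -scalemxAl mxE. Qed.

Lemma linform_mul phi A v : linform phi (A *m v) = linform (phi *m A) v.
Proof. by rewrite /linform mulmxA. Qed.

Lemma linform_le phi v : `|linform phi v| <= n.+1%:R * `|phi| * `|v|.
Proof. exact: le_trans (mx_entry_le _ _ _) (mx_norm_mul _ _). Qed.

Lemma linform_neq0 phi : phi != 0 -> exists v, linform phi v = 1.
Proof.
move=> phi0; have [i hi] : exists i, phi 0 i != 0.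
  by apply/existsP; apply: contraR phi0 => /existsPn H; apply/eqP/rowP => i;
    rewrite mxE; apply/eqP; move: (H i); rewrite negbK.
exists ((phi 0 i)^-1 *: delta_mx i 0).
by rewrite linformZ /linform -colE mxE mulVf.
Qed.

Lemma linform_eq phi phi' : linform phi =1 linform phi' -> phi = phi'.
Proof.
move=> H; apply/rowP => i; have := H (delta_mx i 0).
by rewrite /linform -!colE !mxE.
Qed.

Lemma continuous_mulmx m k (A : 'M[R]_(m, k)) :
  continuous (fun v : 'cV[R]_k => A *m v).
Proof.
move=> v; apply/(@cvgrPdist_le _ _ _ (nbhs v)) => e e0.
have d0 : 0 < k%:R * `|A| + 1 :> R by rewrite ltr_wpDl// mulr_ge0.
near=> w; rewrite -mulmxBr (le_trans (mx_norm_mul _ _))//.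
apply: (@le_trans _ _ ((k%:R * `|A| + 1) * `|v - w|)).
  by rewrite ler_wpM2r// lerDl.
rewrite mulrC -ler_pdivlMr//; near: w.
by apply: (@cvgr_dist_le _ _ _ _ _ id v); [exact: cvg_id|rewrite divr_gt0].
Unshelve. all: end_near. Qed.

Lemma continuous_linform phi : continuous (linform phi).
Proof.
move=> v; have := continuous_mulmx (A := phi) (x := v).
move=> /(@cvg_comp _ _ _ _ (fun M : 'M[R]_1 => M 0 0) _ _ _); apply.
exact: coord_continuous.
Qed.

End Linform.

(** * Convex cones *)

Section Cones.
Context {R : realType} {n : nat}.
Local Notation V := 'cV[R]_n.+1.
Implicit Types (C : set V) (phi : 'rV[R]_n.+1).

Definition open_convex_cone C : Prop :=
  [/\ open C, forall u v, C u -> C v -> C (u + v)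
    & forall t u, 0 < t -> C u -> C (t *: u)].

Lemma open_ballP C x : open C -> C x ->
  exists2 e : R, 0 < e & forall u, `|u| <= e -> C (x + u).
Proof.
move=> oC Cx; have /nbhs_ballP[e /= e0 he] : nbhs x C by apply: open_nbhs_nbhs.
exists (e / 2); first by rewrite divr_gt0.
move=> u ue; apply: he; rewrite -ball_normE /= opprD addNKr normrN.
by rewrite (le_lt_trans ue)// ltr_pdivrMr// ltr_pMr// ltr1n.
Qed.

Lemma openP_ball C : (forall x, C x ->
  exists2 e : R, 0 < e & forall u, `|u| <= e -> C (x + u)) -> open C.
Proof.
move=> H; rewrite openE => x /H[e e0 he]; apply/nbhs_ballP; exists e => //= y.
rewrite -ball_normE /= => xy; have -> : y = x + (y - x) by rewrite addrC subrK.
by apply: he; rewrite distrC ltW.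
Qed.

Lemma closureP_ball (A : set V) x : closure A x <->
  forall e : R, 0 < e -> exists2 y, A y & `|x - y| < e.
Proof.
split=> [cl e e0|H U /nbhs_ballP[e /= e0 he]].
  have [y [Ay]] := cl _ (nbhsx_ballx x _ e0).
  by rewrite -ball_normE /= => xy; exists y.
by have [y Ay xy] := H e e0; exists y; split => //; apply: he; rewrite -ball_normE.
Qed.

(** Approximate [v] by a point of [C]; openness at [u] absorbs the error. *)
Lemma cone_addcl C u v : open_convex_cone C -> C u -> closure C v -> C (u + v).
Proof.
move=> [oC CD _] Cu /closureP_ball clv; have [e e0 he] := open_ballP oC Cu.
have [w Cw vw] := clv e e0.
have -> : u + v = (u + (v - w)) + w by rewrite -addrA subrK.
by apply: CD => //; apply: he; exact: ltW.
Qed.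

(** Applied to the parabolic point [p], this is the horoball property: moving up along [p] never
    leaves the cone. *)
Lemma cone_add_ge0 C u p t :
  open_convex_cone C -> C u -> closure C p -> 0 <= t -> C (u + t *: p).
Proof.
move=> oC Cu clp; rewrite le_eqVlt => /predU1P[<-|t0]; first by rewrite scale0r addr0.
have [_ _ CZ] := oC.
have -> : u + t *: p = t *: (t^-1 *: u + p).
  by rewrite scalerDr scalerA divff ?gt_eqF// scale1r.
apply: (CZ) => //; apply: cone_addcl => //.
by apply: CZ; rewrite ?invr_gt0.
Qed.

Lemma linform_closure_ge phi C c : (forall v, C v -> c * `|v| <= linform phi v) ->
  forall v, closure C v -> c * `|v| <= linform phi v.
Proof.
move=> H v /closureP_ball cl; rewrite leNgt; apply/negP => lt.
(* Both sides of the inequality are Lipschitz; [K] exceeds the sum of their constants, and the 1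
   keeps it positive. *)
pose K := n.+1%:R * `|phi| + `|c| + 1.
have K0 : 0 < K by rewrite ltr_wpDl// addr_ge0// mulr_ge0.
have [|w Cw vw] := cl ((c * `|v| - linform phi v) / K).
  by rewrite divr_gt0// subr_gt0.
have := H w Cw.
have h1 := linform_le phi (v - w); rewrite linformB in h1.
have h2 : `|c * `|v| - c * `|w| | <= `|c| * `|v - w|.
  by rewrite -mulrBr normrM ler_wpM2l// ler_dist_dist.
move: vw; rewrite ltr_pdivlMr// /K => vw.
move: h1 h2; rewrite !ler_norml => /andP[h1 _] /andP[_ h2].
have := normr_ge0 (v - w); move: vw h1 h2; set d := `|v - w|; nra.
Qed.

(* [A (x + u)] and [A (x - u)] lie in C and sum to [2 A x], so properness of C
   bounds both. *)
Lemma cone_mx_norm_le phi C c e x (A : 'M[R]_n.+1) :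
  0 < c -> (forall v, C v -> c * `|v| <= linform phi v) ->
  0 < e -> (forall u, `|u| <= e -> C (x + u)) ->
  (forall v, C v -> C (A *m v)) ->
  `|A| <= 3%:R / (c * e) * linform phi (A *m x).
Proof.
move=> c0 Cphi e0 he AC.
have phi_ge0 v : C v -> 0 <= linform phi v.
  by move=> /Cphi; apply: le_trans; rewrite mulr_ge0// ltW.
have Cx : C x by have := he 0; rewrite normr0 addr0; apply; exact: ltW.
apply: mx_norm_le_col => [|u u1].
  by rewrite mulr_ge0 ?phi_ge0 ?divr_ge0 ?mulr_ge0 ?(ltW c0) ?(ltW e0)//; exact: AC.
have ue : `|e *: u| <= e by rewrite normrZ gtr0_norm// ler_piMr// ltW.
have C1 : C (A *m (x + e *: u)) by apply/AC/he.
have C2 : C (A *m (x + - (e *: u))) by apply/AC/he; rewrite normrN.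
have s2 : linform phi (A *m (x + e *: u)) + linform phi (A *m (x + - (e *: u)))
    = 2%:R * linform phi (A *m x).
  by rewrite -linformD -mulmxDr addrACA subrr addr0 mulmxDr linformD mulr2n mulrDl mul1r.
have b1 : c * `|A *m (x + e *: u)| <= 2%:R * linform phi (A *m x).
  by rewrite (le_trans (Cphi _ C1))// -s2 lerDl phi_ge0.
have b2 := Cphi _ (AC _ Cx).
(* The two terms are bounded by [b1] and [b2], whose coefficients 2 and 1 add up to the 3 of the
   statement. *)
have -> : A *m u = e^-1 *: (A *m (x + e *: u) - A *m x).
  by rewrite mulmxDr addrC addKr -scalemxAr scalerA mulVf ?gt_eqF// scale1r.
rewrite normrZ gtr0_norm ?invr_gt0// mulrC ler_pdivrMr//.
rewrite (le_trans (ler_normB _ _))//.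
have -> : 3%:R / (c * e) * linform phi (A *m x) * e =
    (2%:R * linform phi (A *m x)) / c + linform phi (A *m x) / c.
  by field; rewrite !gt_eqF.
by apply: lerD; rewrite ler_pdivlMr// mulrC.
Qed.

(** Transposition carries the claim to row vectors, to which [bounded_closed_compact] applies. *)
Lemma closed_bounded_compact (F : set V) (M : R) :
  closed F -> (forall v, F v -> `|v| <= M) -> compact F.
Proof.
move=> cF FM.
have cT : continuous (fun v : 'rV[R]_n.+1 => v^T).
  move=> v; apply/(@cvgrPdist_le _ _ _ (nbhs v)) => e e0.
  near=> w; rewrite -linearB mx_norm_tr; near: w.
  by apply: (@cvgr_dist_le _ _ _ _ _ id v); [exact: cvg_id|].
have -> : F = (fun v : 'rV[R]_n.+1 => v^T) @` ((fun v : 'rV[R]_n.+1 => v^T) @^-1` F).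
  apply/seteqP; split=> [v Fv|_ [v Fv <-]] //.
  by exists v^T; rewrite /= trmxK.
apply: continuous_compact; first exact: continuous_subspaceT.
apply: bounded_closed_compact; last by apply: preimage_closed.
exists M; split; first exact: num_real.
by move=> x Mx v /FM; rewrite mx_norm_tr => /le_trans; apply; exact: ltW.
Unshelve. all: end_near. Qed.

Lemma compact_linform_gt0 phi (F : set V) (M : R) :
  closed F -> (forall v, F v -> `|v| <= M) ->
  (forall v, F v -> 0 < linform phi v) ->
  exists2 c : R, 0 < c & forall v, F v -> c <= linform phi v.
Proof.
move=> cF FM Fpos; have cpF := closed_bounded_compact cF FM.
have [->|/set0P F0] := eqVneq F set0; first by exists 1 => // v [].
have [|c Fc hc] := @compact_EVT_min _ R (linform phi) F F0 cpF.
  exact/continuous_subspaceT/continuous_linform.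
by exists (linform phi c); [exact/Fpos/set_mem|move=> v Fv; exact/hc/mem_set].
Qed.

End Cones.

(** * Horoball properties of the cone over a cusp neighbourhood *)

Section Core.
Context {R : realType} {n : nat}.
Local Notation V := 'cV[R]_n.+1.
Variables (C D : set V) (S : set 'M[R]_n.+1).
Variables (psi : 'rV[R]_n.+1) (p : V).
Hypothesis oD : open_convex_cone D.
Hypothesis SD : forall A v, S A -> D v -> D (A *m v).
Hypothesis clDp : closure D p.
Hypothesis psiD : forall v, D v -> 0 < linform psi v.
Hypothesis D0 : D !=set0.
Hypothesis cobounded : forall x, linform psi x = 1 -> exists M : R, forall v,
  linform psi v = 1 -> exists A s, S A /\ `|v - A *m x + s *: p| <= M.

Lemma cusp_cone_normalized : exists2 x, D x & linform psi x = 1.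
Proof.
have [y Dy] := D0; have y0 := psiD Dy; have [_ _ DZ] := oD.
exists ((linform psi y)^-1 *: y); first by apply: DZ; rewrite ?invr_gt0.
by rewrite linformZ mulVf// gt_eqF.
Qed.

(* With [x] in D and [y = 2v - x], some translate of [x] is close to
   [x + N (y - x)] modulo [p], so that [y] is almost in D modulo [p], and [v]
   is the midpoint of [x] and [y]. *)
Lemma cusp_cone_full v : linform psi v = 1 -> exists t, D (v + t *: p).
Proof.
move=> v1; have [x Dx x1] := cusp_cone_normalized.
have [M HM] := cobounded x1; have [opD DD DZ] := oD.
have [e e0 he] := open_ballP opD Dx.
have [N HN] : exists N : nat, `|M| / e < N.+1%:R.
  have /archi_boundP : 0 <= `|M| / e by rewrite divr_ge0// ltW.
  by move=> h; exists (Num.bound (`|M| / e)); rewrite (lt_le_trans h)// ler_nat.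
set K : R := N.+1%:R + 1.
have K0 : 0 < K by rewrite ltr_wpDl.
pose d := 2%:R *: (v - x).
have [|A [s [SA hA]]] := HM (x + K *: d).
  by rewrite linformD !linformZ linformB v1 x1 subrr !mulr0 addr0.
set r := x + K *: d - A *m x + s *: p in hA.
(* This point equals x + d + (s/K) p - r/K, and the point x + r/K of [D2] lies in the ball about [x]
   because K > M/e. The errors r/K cancel in the sum, which is 2v + (s/K) p. *)
have D1 : D ((1 - K^-1) *: x + K^-1 *: (A *m x)).
  have K1 : 0 < 1 - K^-1 by rewrite subr_gt0 invf_lt1// ltrDr ltr0n.
  by apply: DD; apply: (DZ); rewrite ?invr_gt0//; exact: SD.
have D2 : D (x + K^-1 *: r).
  apply: he; rewrite normrZ gtr0_norm ?invr_gt0// mulrC ler_pdivrMr//.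
  rewrite (le_trans hA)// (le_trans (ler_norm _))// mulrC -ler_pdivrMr//.
  by rewrite (le_trans (ltW HN))// lerDl.
have Ax : A *m x = x + K *: d + s *: p - r.
  by rewrite /r; move: (A *m x) => w; apply/colP => i; rewrite !mxE; ring.
exists (s / K / 2%:R).
have -> : v + (s / K / 2%:R) *: p = 2%:R^-1 *:
    (((1 - K^-1) *: x + K^-1 *: (A *m x)) + (x + K^-1 *: r)).
  have Kn : K != 0 by rewrite gt_eqF.
  rewrite Ax /d; apply/colP => i; rewrite !mxE; field.
  by rewrite Kn.
by apply: DZ; rewrite ?invr_gt0//; apply: DD.
Qed.

Lemma cusp_cone_ge v t s : t <= s -> D (v + t *: p) -> D (v + s *: p).
Proof.
move=> ts Dv; have -> : v + s *: p = v + t *: p + (s - t) *: p.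
  by rewrite -addrA -scalerDl [t + _]addrC subrK.
by apply: cone_add_ge0 => //; rewrite subr_ge0.
Qed.

(** Over each point of the slice some height works together with a neighbourhood, by
    [cusp_cone_full] and openness; compactness of the bounded slice makes the height and the radius
    uniform. *)
Lemma cusp_cone_deep (M : R) : exists T e : R, [/\ 0 <= T, 0 < e &
  forall z u, linform psi z = 1 -> `|z| <= M -> `|u| <= e -> D (z + T *: p + u)].
Proof.
pose F := [set z : V | linform psi z = 1 /\ `|z| <= M].
have cF : closed F.
  apply: closedI.
    apply: (@preimage_closed _ _ (linform psi) [set 1]); last exact: closed_eq.
    by move=> ? _; exact: continuous_linform.
  apply: (@preimage_closed _ _ (fun z : V => `|z|) [set x | x <= M]).
    by move=> ? _; exact: norm_continuous.
  exact: closed_le.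
have /compact_near_coveringP cov : compact F.
  by apply: (@closed_bounded_compact _ _ F M) => // z [].
(* The radius is tied to the height as [T^-1], so that a single parameter tending to infinity
   controls both. *)
pose P (T : R) (z : V) := forall u, `|u| <= T^-1 -> D (z + T *: p + u).
have := cov R (pinfty_nbhs R) P _.
have H z : F z -> \forall z' \near z & T \near +oo%R, P T z'.
  move=> [z1 _]; have [t Dt] := cusp_cone_full z1; have [opD DD DZ] := oD.
  have [e e0 he] := open_ballP opD Dt.
  exists (ball z (e / 2), [set T : R | Num.max t (2 / e) < T]).
    split; first by apply: nbhsx_ballx; rewrite divr_gt0.
    exists (Num.max t (2 / e)); split; first exact: num_real.
    by [].
  move=> [z' T] [/=]; rewrite -ball_normE /= gt_max => zz' /andP[tT eT] u uT.
  rewrite addrAC; apply: cusp_cone_ge (ltW tT) _.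
  have -> : z' + u + t *: p = z + t *: p + ((z' - z) + u).
    by apply/colP => i; rewrite !mxE; ring.
  apply: he; rewrite (le_trans (ler_normD _ _))// [leRHS]splitr lerD//.
    by rewrite distrC ltW.
  rewrite (le_trans uT)// -[leRHS]invrK lef_pV2 ?posrE ?invf_div ?(ltW eT)//.
    by rewrite (lt_trans _ eT)// divr_gt0.
  by rewrite divr_gt0.
move=> /(_ _ H) [T [_ HT]].
pose T' := Num.max T 0 + 1.
have T'0 : 0 < T' by rewrite ltr_wpDl// le_max lexx orbT.
exists T', T'^-1; split; rewrite ?invr_gt0//; first exact: ltW.
move=> z u z1 zM uT; apply: (HT T') => //.
by rewrite (@le_lt_trans _ _ (Num.max T 0)) ?le_max ?lexx// ltrDl.
Qed.

End Core.

(** * A lower bound for psi on the orbit of p *)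

Section OrbitGap.
Context {R : realType} {n : nat}.
Local Notation V := 'cV[R]_n.+1.
(* [D] is the cone over a cusp neighbourhood of [p], and [S] is its stabilizer. *)
Variables (C D : set V) (G S : set 'M[R]_n.+1).
Variables (phi psi : 'rV[R]_n.+1) (c : R) (p : V).
Hypotheses (oC : open_convex_cone C) (oD : open_convex_cone D) (DC : D `<=` C).
Hypotheses (c0 : 0 < c) (Cphi : forall v, C v -> c * `|v| <= linform phi v).
Hypothesis GM : forall A B, G A -> G B -> G (A *m B).
Hypothesis GV : forall A, G A -> A \in unitmx /\ G (invmx A).
Hypothesis Gdet : forall A, G A -> `|\det A| = 1.
Hypothesis GC : forall A v, G A -> C v -> C (A *m v).
Hypothesis SG : S `<=` G.
Hypothesis SV : forall A, S A -> S (invmx A).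
Hypothesis Sp : forall A, S A -> A *m p = p.
Hypothesis Spsi : forall A, S A -> psi *m A = psi.
Hypothesis SD : forall A v, S A -> D v -> D (A *m v).
Hypothesis D0 : D !=set0.
Hypotheses (p0 : p != 0) (clDp : closure D p).
Hypotheses (psip : linform psi p = 0) (psiC : forall v, C v -> 0 < linform psi v).
Hypothesis cobounded1 : exists M : R, forall v,
  linform psi v = 1 -> exists A s, S A /\ `|A *m v + s *: p| <= M.
Hypothesis cobounded2 : forall x, linform psi x = 1 -> exists M : R, forall v,
  linform psi v = 1 -> exists A s, S A /\ `|v - A *m x + s *: p| <= M.
Hypothesis GD : forall A x, G A -> D x -> D (A *m x) -> S A.
Hypothesis GpC : forall A, G A -> ~ C (A *m p).
Hypothesis Gpsi : forall A, G A -> A *m p = p \/ 0 < linform psi (A *m p).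

Let clCp : closure C p. Proof. exact: closureS clDp. Qed.

Let phip : 0 < linform phi p.
Proof.
by rewrite (lt_le_trans _ (linform_closure_ge Cphi clCp))// mulr_gt0// normr_gt0.
Qed.

Let phiGp A : G A -> 0 <= linform phi (A *m p).
Proof.
move=> GA; rewrite linform_mul.
have := @linform_closure_ge _ _ (phi *m A) C 0 _ p clCp; rewrite mul0r; apply.
move=> v Cv; rewrite mul0r -linform_mul (le_trans _ (Cphi (GC GA Cv)))//.
by rewrite mulr_ge0// ltW.
Qed.

Lemma parabolic_orbit_gap : exists2 d : R, 0 < d &
  forall A, G A -> A *m p = p \/ d <= linform psi (A *m p).
Proof.
have psiD v : D v -> 0 < linform psi v by move=> /DC/psiC.
have [opD _ DZ] := oD; have [_ _ CZ] := oC.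
have [x0 Dx0 x01] := cusp_cone_normalized oD psiD D0.
have [e0 e00 he0] := open_ballP opD Dx0.
have [M HM] := cobounded1.
have [T [e [T0 epos deep]]] := cusp_cone_deep oD SD clDp psiD D0 cobounded2 M.
have N0 : 0 <= n.+1%:R :> R by [].
have M0 : 0 <= M.
  by have [A [s [_ /(le_trans _)]]] := HM _ x01; apply.
(* If [phi] is nonnegative at [v], then its value at [v + s *: p] is at least s phi(p); bounding
   that value by the norm gives s <= [K1]. *)
pose K1 := n.+1%:R * `|phi| * M / linform phi p.
have K10 : 0 <= K1 by rewrite divr_ge0 ?(ltW phip)// !mulr_ge0.
pose M1 := M + (T + K1) * `|p|.
have M10 : 0 <= M1 by rewrite addr_ge0// mulr_ge0// addr_ge0.
(* Over a bounded part of [psi = 1], the points outside D have bounded height,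
   the height being the coordinate along [p]. *)
have low v s : linform psi v = 1 -> ~ D v -> 0 <= linform phi v ->
    `|v + s *: p| <= M -> [/\ 0 <= T + s, T + s <= T + K1 & `|v| <= M1].
  move=> v1 Dv phiv vM.
  have s1 : linform psi (v + s *: p) = 1 by rewrite linformD linformZ psip mulr0 addr0.
  have Ts : 0 <= T + s.
    (* Otherwise [v] would lie above v + (s + T) p, which is in [D] by [deep]. *)
    rewrite leNgt; apply/negP => Ts; apply: Dv.
    have /(cusp_cone_ge oD clDp (s := - s)) : D (v + s *: p + T *: p).
      by rewrite -[X in D X]addr0; apply: deep; rewrite // normr0 ltW.
    by rewrite -addrA -scalerDl subrr scale0r addr0; apply; lra.
  have sK : s <= K1.
    rewrite /K1 ler_pdivlMr//.
    have := linform_le phi (v + s *: p); rewrite linformD linformZ => h.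
    have := ler_wpM2l (mulr_ge0 N0 (normr_ge0 phi)) vM => h'.
    by have := ler_norm (linform phi v + s * linform phi p); lra.
  split=> //; first by lra.
  have -> : v = (v + s *: p) - s *: p by rewrite addrK.
  rewrite (le_trans (ler_normB _ _))// /M1 lerD// normrZ ler_wpM2r//.
  by rewrite ler_norml; lra.
(* With a = psi(A p) and l = psi(y), the three constants will give: norm of E^-1 at most K5 l, then
   1/l at most K6 a, then norm of E at most K7 a. *)
pose K5 := 3%:R / (c * e0) * (n.+1%:R * `|phi| * M1).
pose K6 := n.+1%:R * K5 * M1 / `|p|.
pose K7 := 3%:R / (c * e) * (n.+1%:R * `|phi| * (K6 * `|x0| + (T + K1) * M1)).
have [c_ge0 e0_ge0 e_ge0] := And3 (ltW c0) (ltW e00) (ltW epos).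
have K50 : 0 <= K5 by do ![apply: mulr_ge0 | rewrite invr_ge0] => //.
have K60 : 0 <= K6 by do ![apply: mulr_ge0 | rewrite invr_ge0] => //.
have K70 : 0 <= K7.
  have ? : 0 <= K6 * `|x0| + (T + K1) * M1 by rewrite addr_ge0// mulr_ge0// addr_ge0.
  by rewrite mulr_ge0// ?mulr_ge0// invr_ge0 mulr_ge0.
have f0 : 0 < (n.+1)`!%:R :> R by rewrite ltr0n fact_gt0.
(* For a below this bound, (n+1)! K7 a < 1, which forces the determinant of [E] below 1 in absolute
   value. *)
exists ((n.+1)`!%:R * (K7 + 1))^-1; first by rewrite invr_gt0 mulr_gt0// ltr_wpDl.
move=> A GA; have [->|a0] := Gpsi GA; first by left.
have [Ap|Ap] := pselect (A *m p = p); [by left|right].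
set a := linform psi (A *m p) in a0 *.
have [|B [s [SB hB]]] := HM (a^-1 *: (A *m p)).
  by rewrite linformZ mulVf// gt_eqF.
have GB := SG SB; have [uB GB'] := GV GB.
pose F := B *m A; have GF : G F by exact: GM.
have Fp : B *m (a^-1 *: (A *m p)) = a^-1 *: (F *m p) by rewrite -scalemxAr mulmxA.
have aV : 0 < a^-1 by rewrite invr_gt0.
(* The vector F p / a lies on psi = 1 and, by [GpC], outside C and hence outside [D], so [low]
   bounds its norm. *)
have FpM : `|F *m p| <= M1 * a.
  rewrite Fp in hB; have [|||_ _] := low _ _ _ _ _ hB.
  - rewrite linformZ -mulmxA linform_mul Spsi// -/a mulVf// gt_eqF//.
  - move=> /DC/(CZ a _ a0); rewrite scalerA divff ?gt_eqF// scale1r; exact: GpC.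
  - by rewrite linformZ mulr_ge0 ?phiGp// ltW.
  by rewrite normrZ gtr0_norm// mulrC ler_pdivrMr.
have [uF GF'] := GV GF.
pose y := invmx F *m x0; have Cy : C y by apply: GC => //; exact: DC.
have Fy : F *m y = x0 by rewrite mulmxA mulmxV// mul1mx.
(* If [y] and F y = x0 were both in [D], then [F] would be in [S] and fix [p]; as [B] fixes [p] too,
   so would [A]. *)
have Dy : ~ D y.
  move=> Dy; have SF : S F by apply: (GD GF Dy); rewrite Fy.
  by apply: Ap; rewrite -[RHS](Sp (SV SB)) -[in RHS](Sp SF) -mulmxA mulKmx.
have l0 := psiC Cy; set l := linform psi y in l0.
have lV : 0 < l^-1 by rewrite invr_gt0.
have [|B' [s' [SB' hB']]] := HM (l^-1 *: y).
  by rewrite linformZ mulVf// gt_eqF.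
have GB2 := SG SB'; have [uB' GB2'] := GV GB2.
set z := B' *m (l^-1 *: y) + s' *: p in hB'.
have zE : B' *m (l^-1 *: y) = l^-1 *: (B' *m y) by rewrite -scalemxAr.
have [|||Ts1 Ts2 vM1] := low _ _ _ _ _ hB'.
- by rewrite linform_mul Spsi// linformZ mulVf// gt_eqF.
- move=> /(DZ l _ l0); rewrite zE scalerA divff ?gt_eqF// scale1r => /(SD (SV SB')).
  by rewrite mulKmx.
- rewrite (le_trans _ (Cphi (GC GB2 (CZ _ _ lV Cy))))//.
  by rewrite mulr_ge0// ltW.
have z1 : linform psi z = 1.
  by rewrite linformD linformZ psip mulr0 addr0 linform_mul Spsi// linformZ mulVf// gt_eqF.
(* [E] sends B' y to x0, and E p = F p because B' fixes [p]. *)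
pose E := F *m invmx B'; have GE : G E by exact: GM.
have [uE GE'] := GV GE.
have B'p : invmx B' *m p = p by exact/Sp/SV.
have Ep : E *m p = F *m p by rewrite -mulmxA B'p.
have Ekap : E *m (z + T *: p) = l^-1 *: x0 + (T + s') *: (F *m p).
  rewrite -addrA -scalerDl [s' + T]addrC mulmxDr -[E *m (_ *: p)]scalemxAr Ep; congr (_ + _).
  by rewrite zE -scalemxAr /E -mulmxA mulKmx// Fy.
have EVx0 : invmx E *m x0 = B' *m y.
  have -> : x0 = E *m (B' *m y) by rewrite /E -mulmxA mulKmx.
  by rewrite mulKmx.
have EVl : `|invmx E| <= K5 * l.
  have := cone_mx_norm_le c0 Cphi e00 (fun u h => DC (he0 u h)) (fun v => GC GE' (v := v)).
  move=> /le_trans; apply; rewrite EVx0 /K5 -[leRHS]mulrA ler_wpM2l ?divr_ge0 ?mulr_ge0//.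
  have -> : B' *m y = l *: (B' *m (l^-1 *: y)).
    by rewrite zE scalerA divff ?scale1r// gt_eqF.
  rewrite linformZ mulrC ler_wpM2r ?(ltW l0)//.
  by rewrite (le_trans (ler_norm _))// (le_trans (linform_le _ _))// ler_wpM2l// mulr_ge0.
have np : 0 < `|p| by rewrite normr_gt0.
(* E^-1 stretches the vector F p, of size O(a), to [p], while its norm is O(l). *)
have lVa : l^-1 <= K6 * a.
  have : `|p| <= n.+1%:R * (K5 * l) * (M1 * a).
    have {1}-> : p = invmx E *m (F *m p) by rewrite -Ep mulKmx.
    rewrite (le_trans (mx_norm_mul _ _))// ler_pM ?mulr_ge0//.
    by rewrite ler_wpM2l.
  move=> h; rewrite -[l^-1]mul1r ler_pdivrMr//.
  have -> : K6 * a * l = n.+1%:R * (K5 * l) * (M1 * a) / `|p| by rewrite /K6; ring.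
  by rewrite ler_pdivlMr// mul1r.
have phiE : linform phi (E *m (z + T *: p)) <=
    n.+1%:R * `|phi| * (K6 * `|x0| + (T + K1) * M1) * a.
  rewrite Ekap (le_trans (ler_norm _))// (le_trans (linform_le _ _))// -[leRHS]mulrA.
  rewrite ler_wpM2l ?mulr_ge0// (le_trans (ler_normD _ _))// !normrZ mulrDl.
  rewrite gtr0_norm// ger0_norm// lerD//.
    by rewrite mulrAC ler_wpM2r.
  by rewrite -mulrA ler_pM.
(* By [deep], z + T p is the centre of a ball of radius [e] in [D], so the size of its image under
   [E] bounds the norm of [E]. *)
have Ea : `|E| <= K7 * a.
  have := cone_mx_norm_le c0 Cphi epos (fun u h => DC (deep z u z1 hB' h))
    (fun v => GC GE (v := v)).
  by move=> /le_trans; apply; rewrite /K7 -[leRHS]mulrA ler_wpM2l// divr_ge0// mulr_ge0.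
rewrite leNgt; apply/negP; rewrite -[X in _ < X]div1r ltr_pdivlMr ?mulr_gt0 ?ltr_wpDl// => lt1.
have K7a : (n.+1)`!%:R * (K7 * a) < 1.
  rewrite (le_lt_trans _ lt1)// -subr_ge0.
  by rewrite (_ : _ - _ = (n.+1)`!%:R * a); [rewrite mulr_ge0// ltW|ring].
have Ka0 : 0 <= K7 * a := mulr_ge0 K70 (ltW a0).
have K7a1 : K7 * a <= 1.
  rewrite (le_trans _ (ltW K7a))// ler_peMl//.
  by rewrite ler1n fact_gt0.
have : `|\det E| <= (n.+1)`!%:R * (K7 * a).
  rewrite (le_trans (det_norm_le _))// ler_wpM2l//.
  rewrite (@le_trans _ _ ((K7 * a) ^+ n.+1))//.
    by rewrite lerXn2r ?nnegrE.
  by rewrite exprS ler_piMr// exprn_ile1.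
by rewrite Gdet// leNgt K7a.
Qed.

End OrbitGap.

(** * Crystallographic groups isomorphic to Z^m *)

Section Orthogonal.
Context {R : realType} {m : nat}.
Implicit Types (A : 'M[R]_m) (x : 'rV[R]_m).

Lemma mulmx_tr_eq0 x : x *m x^T = 0 -> x = 0.
Proof.
move=> /matrixP/(_ 0 0); rewrite !mxE => x0; apply/rowP => i; rewrite mxE.
apply/eqP; rewrite -sqrf_eq0 expr2; apply/eqP.
have /psumr_eq0P : forall j : 'I_m, true -> 0 <= x 0 j * x^T j 0.
  by move=> j _; rewrite mxE -expr2 sqr_ge0.
by move=> /(_ x0 i isT); rewrite mxE.
Qed.

Lemma orthogonal_norm_le A : A *m A^T = 1%:M -> `|A| <= 1.
Proof.
move=> /matrixP AA; apply: mx_norm_le => // i j.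
rewrite -[leRHS](@normr1 R) -ler_sqr ?nnegrE// !real_normK ?num_real// expr1n.
have := AA i i; rewrite !mxE eqxx mulr1n => <-; rewrite (bigD1 j)//= mxE -expr2.
by rewrite lerDl sumr_ge0// => k _; rewrite mxE -expr2 sqr_ge0.
Qed.

Lemma orthogonal_norm_mul A x : A *m A^T = 1%:M -> `|x *m A| <= m%:R * `|x|.
Proof.
move=> /orthogonal_norm_le A1; rewrite (le_trans (mx_norm_mul _ _))//.
by rewrite -[leRHS]mulr1 ler_wpM2l// mulr_ge0.
Qed.

(** Fixed vectors of an orthogonal matrix are orthogonal to the image of 1 - A: if x A = x, then x
    A^T = x as well, so x pairs to 0 with y (1 - A), that is, with itself. *)
Lemma orthogonal_fixed_im A x y :
  A *m A^T = 1%:M -> x *m A = x -> x = y *m (1%:M - A) -> x = 0.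
Proof.
move=> AA xA xy; apply: mulmx_tr_eq0; rewrite [X in _ *m X^T]xy trmx_mul mulmxA.
rewrite linearB /= trmx1 mulmxBr mulmx1 -[X in _ - X *m _]xA -mulmxA AA mulmx1.
by rewrite subrr mul0mx.
Qed.

(** The kernel and the image of 1 - A meet trivially by [orthogonal_fixed_im], so they span by
    rank. *)
Lemma orthogonal_decomp A x : A *m A^T = 1%:M ->
  exists y z, [/\ y *m A = y & x = y + z *m (1%:M - A)].
Proof.
move=> AA; set N := 1%:M - A.
have cap0 : (kermx N :&: N)%MS = 0.
  apply/eqP/rowV0P => v; rewrite sub_capmx => /andP[/sub_kermxP vN /submxP[w vw]].
  apply: (orthogonal_fixed_im AA _ vw).
  by apply/esym/eqP; rewrite -subr_eq0 -{1}[v]mulmx1 -mulmxBr vN.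
have rf : row_full (kermx N + N)%MS.
  by rewrite -col_leq_rank mxrank_disjoint_sum// mxrank_ker subnK ?rank_leq_row.
have /sub_addsmxP[[u w] /= ->] := submx_full x rf.
exists (u *m kermx N), w; split => //.
apply/esym/eqP; rewrite -subr_eq0 -{1}[u *m _]mulmx1 -mulmxBr -/N.
by rewrite -mulmxA mulmx_ker mulmx0.
Qed.

End Orthogonal.

Lemma int_multiples_ind (V : zmodType) (P : V -> Prop) :
  P 0 -> (forall a b, P a -> P b -> P (a + b)) -> (forall a, P a -> P (- a)) ->
  forall e (z : int), P e -> P (e *~ z).
Proof.
move=> P0 PD PN e z Pe; have H k : P (e *+ k).
  by elim: k => [|k IH]; rewrite ?mulr0n// mulrS; exact: PD.
case: z => k; first exact: H.
by rewrite NegzE mulrNz; apply: PN; exact: H.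
Qed.

Lemma row_int_sum m (a : 'rV[int]_m) : a = \sum_i delta_mx 0 i *~ a 0 i.
Proof.
rewrite [LHS]row_sum_delta; apply: eq_bigr => i _.
by rewrite -scaler_int intz.
Qed.

(** * Proper isometric actions of Z^m on R^m: [a] acts on row vectors by x -> x rot(a) + tr(a) *)

Section Bieberbach.
Context {R : realType} {m : nat}.
Variables (rot : 'rV[int]_m -> 'M[R]_m) (tr : 'rV[int]_m -> 'rV[R]_m).
Hypothesis rot_orth : forall a, rot a *m (rot a)^T = 1%:M.
Hypothesis rotD : forall a b, rot (a + b) = rot a *m rot b.
Hypothesis trD : forall a b, tr (a + b) = tr a *m rot b + tr b.
Hypothesis proper : forall r : R, finite_set [set a | `|tr a| <= r].

Let rot0 : rot 0 = 1%:M.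
Proof.
have := rotD 0 0; rewrite addr0 => /(congr1 (mulmx^~ (rot 0)^T)).
by rewrite -mulmxA rot_orth mulmx1.
Qed.

Let tr0 : tr 0 = 0.
Proof.
have := trD 0 0; rewrite addr0 rot0 mulmx1 => /eqP.
by rewrite -subr_eq0 opprD addNKr oppr_eq0 => /eqP.
Qed.

Let rotC a b : rot a *m rot b = rot b *m rot a.
Proof. by rewrite -!rotD addrC. Qed.

Let rotN a : rot a *m rot (- a) = 1%:M.
Proof. by rewrite -rotD subrr rot0. Qed.

Let e_ (i : 'I_m) : 'rV[int]_m := delta_mx 0 i.

(* The translation part of a generator along its axis. *)
Let axis_ex i : exists yz : 'rV[R]_m * 'rV[R]_m,
  yz.1 *m rot (e_ i) = yz.1 /\ tr (e_ i) = yz.1 + yz.2 *m (1%:M - rot (e_ i)).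
Proof.
have [y [z [h1 h2]]] := orthogonal_decomp (tr (e_ i)) (rot_orth (e_ i)).
by exists (y, z).
Qed.

Let tau i := (projT1 (cid (axis_ex i))).1.
Let ctr i := (projT1 (cid (axis_ex i))).2.

Let tau_fix i : tau i *m rot (e_ i) = tau i.
Proof. by rewrite /tau; case: cid => /= ? []. Qed.

Let tr_gen i : tr (e_ i) = tau i + ctr i *m (1%:M - rot (e_ i)).
Proof. by rewrite /tau /ctr; case: cid => /= ? []. Qed.

(** Commutation of the generator with [b] puts tau_i rot(b) - tau_i in the image of 1 - rot(e_i); it
    is also fixed by rot(e_i), hence zero. *)
Let tau_rot i b : tau i *m rot b = tau i.
Proof.
apply/eqP; rewrite -subr_eq0; apply/eqP.
have trC : tr b *m rot (e_ i) + tr (e_ i) = tr (e_ i) *m rot b + tr b.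
  by rewrite -!trD addrC.
apply: (@orthogonal_fixed_im _ _ (rot (e_ i)) _
  (- tr b - ctr i *m (rot b - 1%:M))) => //.
  by rewrite mulmxBl -mulmxA -rotC mulmxA tau_fix.
have -> : tau i = tr (e_ i) - ctr i *m (1%:M - rot (e_ i)) by rewrite tr_gen addrK.
move/eqP: trC; rewrite addrC -subr_eq => /eqP trC.
rewrite !mulmxBl !mulmxBr !mulmx1 !mulmxBl !mulNmx -!mulmxA [rot (e_ i) *m _]rotC.
rewrite {1}(_ : tr (e_ i) *m rot b = tr (e_ i) + tr b *m rot (e_ i) - tr b); last first.
  by rewrite -trC; apply/rowP => j; rewrite !mxE; ring.
move: (ctr i *m (rot b *m _)) (ctr i *m rot b) (ctr i *m rot _) (tr b *m _) => x1 x2 x3 x4.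
apply/rowP => j; rewrite !mxE; ring.
Qed.

Let Tau : 'M[R]_m := \matrix_i tau i.
(** The additive extension of [tau]: up to a bounded error, [a] translates by [T a]. *)
Let T (a : 'rV[int]_m) : 'rV[R]_m := map_mx intr a *m Tau.

Let TauE b : Tau *m rot b = Tau.
Proof. by apply/row_matrixP => i; rewrite row_mul !rowK tau_rot. Qed.

Let TD a b : T (a + b) = T a + T b.
Proof. by rewrite /T map_mxD mulmxDl. Qed.

Let T_rot a b : T a *m rot b = T a.
Proof. by rewrite /T -mulmxA TauE. Qed.

Let T_gen i : T (e_ i) = tau i.
Proof. by rewrite /T map_delta_mx -rowE rowK. Qed.

Let dev a := tr a - T a.

Let devD a b : dev (a + b) = dev a *m rot b + dev b.
Proof.
by rewrite /dev trD TD mulmxBl T_rot; apply/rowP => j; rewrite !mxE; ring.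
Qed.

(** On the multiples of one generator the cocycle [dev] is a coboundary, and is therefore
    bounded. *)
Let dev_gen i (z : int) : dev (e_ i *~ z) = ctr i - ctr i *m rot (e_ i *~ z).
Proof.
pose P a := dev a = ctr i - ctr i *m rot a.
apply: (int_multiples_ind (P := P)).
- by rewrite /P /dev tr0 rot0 mulmx1 /T map_mx0 mul0mx !subrr.
- by move=> a b; rewrite /P devD rotD => -> ->; rewrite mulmxBl mulmxA addrC subrKA.
- move=> a; rewrite /P => Pa.
  have := devD a (- a); rewrite subrr {1}/dev tr0 /T map_mx0 mul0mx subrr Pa.
  rewrite mulmxBl -mulmxA rotN mulmx1 => /esym/eqP.
  by rewrite addrC addr_eq0 opprB => /eqP.
- by rewrite /P /dev T_gen tr_gen mulmxBr mulmx1 addrC addKr.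
Qed.

(** By the cocycle rule, [dev a] is a sum of m terms, one for each generator, each turned by one
    rotation; a rotation enlarges the maximum norm by a factor of at most m. *)
Let dev_bounded : exists M : R, forall a, `|dev a| <= M.
Proof.
exists (\sum_i m%:R * (`|ctr i| + m%:R * `|ctr i|)) => a.
rewrite {1}(row_int_sum a).
have H r : `|dev (\sum_(i <- r) e_ i *~ a 0 i)| <=
    \sum_(i <- r) m%:R * (`|ctr i| + m%:R * `|ctr i|).
  elim: r => [|i r IH].
    by rewrite !big_nil /dev tr0 /T map_mx0 mul0mx subrr normr0.
  rewrite !big_cons devD (le_trans (ler_normD _ _))// lerD//.
  rewrite (le_trans (orthogonal_norm_mul _ (rot_orth _)))// ler_wpM2l//.
  by rewrite dev_gen (le_trans (ler_normB _ _))// lerD// orthogonal_norm_mul.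
exact: H.
Qed.

Let floor_mx (x : 'rV[R]_m) : 'rV[int]_m := \row_i Num.floor (x 0 i).

Let floor_mx_le x : `|x - map_mx intr (floor_mx x)| <= 1.
Proof.
apply: mx_norm_le => // i j; rewrite !mxE ord1.
have /andP[] := Num.Theory.floor_itv (x 0 j); rewrite intrD1 => h1 h2.
by rewrite ger0_norm ?subr_ge0// lerBlDl ltW// addrC.
Qed.

(** If x Tau = 0 with x nonzero, the roundings of N x to integers have bounded [tr]. By properness
    they are finitely many, although some coordinate of N x grows without bound. *)
Let Tau_unit : Tau \in unitmx.
Proof.
rewrite unitmxE unitfE; apply/negP => /det0P[x x0 xT].
have [M HM] := dev_bounded.
have [i xi] : exists i, x 0 i != 0.
  apply/existsP; apply: contraR x0 => /existsPn H; apply/eqP/rowP => i.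
  by rewrite mxE; apply/eqP; move: (H i); rewrite negbK.
have [s sE] := (finite_seqP _).1 (proper (m%:R * 1 * `|Tau| + M)).
pose a (N : nat) := floor_mx (N%:R *: x).
have aS N : a N \in s.
  suff : [set` s] (a N) by [].
  rewrite -sE /= (_ : tr (a N) = T (a N) + dev (a N)); last by rewrite addrC subrK.
  rewrite (le_trans (ler_normD _ _))// lerD//.
  have -> : T (a N) = - ((N%:R *: x - map_mx intr (a N)) *m Tau).
    by rewrite mulmxBl -scalemxAl xT scaler0 sub0r opprK.
  rewrite normrN (le_trans (mx_norm_mul _ _))// ler_wpM2r//.
  by apply: ler_wpM2l => //; exact: floor_mx_le.
pose b := \max_(c <- s) absz (c ord0 i).
have bP N : N%:R * `|x 0 i| <= b%:R + 1.
  have h : (absz (a N ord0 i) <= b)%N.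
    by exact: (@leq_bigmax_seq _ s xpredT (fun c => absz (c ord0 i))).
  have := le_trans (mx_entry_le _ 0 i) (floor_mx_le (N%:R *: x)).
  rewrite !mxE => h1.
  have h2 : `|(a N 0 i)%:~R : R| <= b%:R.
    by rewrite -intr_norm -abszE -pmulrn ler_nat.
  rewrite -[N%:R]normr_nat -normrM.
  have -> : N%:R * x 0 i = (a N 0 i)%:~R + (N%:R * x 0 i - (a N 0 i)%:~R).
    by rewrite addrC subrK.
  rewrite (le_trans (ler_normD _ _))// lerD//.
  by move: h1; rewrite !mxE.
have xi0 : 0 < `|x 0 i| by rewrite normr_gt0.
have := bP (Num.bound ((b%:R + 1) / `|x 0 i|)).
have /archi_boundP : 0 <= (b%:R + 1) / `|x 0 i| by rewrite divr_ge0// addr_ge0.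
by rewrite ltr_pdivrMr// => /lt_geF ->.
Qed.

(** Write y = x Tau and round [x] to an integer vector; rounding and [dev] cost bounded errors. *)
Lemma cobounded_isometries : exists M : R, forall y, exists a, `|y - tr a| <= M.
Proof.
have [M HM] := dev_bounded; exists (m%:R * 1 * `|Tau| + M) => y.
pose x := y *m invmx Tau; exists (floor_mx x).
have -> : y - tr (floor_mx x) =
    (x - map_mx intr (floor_mx x)) *m Tau - dev (floor_mx x).
  rewrite /dev /T mulmxBl mulmxKV//.
  move: (tr _) (_ *m Tau) => u v.
  by apply/rowP => j; rewrite !mxE; ring.
rewrite (le_trans (ler_normB _ _))// lerD//.
by rewrite (le_trans (mx_norm_mul _ _))// ler_wpM2r// ler_wpM2l// floor_mx_le.
Qed.

End Bieberbach.

(** * Parabolic subgroups of O(n,1) *)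

Section Householder.
Context {R : realType} {m : nat}.

(** The Householder reflection in the hyperplane orthogonal to a - b. *)
Lemma reflection_exists (a b : 'cV[R]_m) : a^T *m a = b^T *m b ->
  exists S : 'M[R]_m, S^T *m S = 1%:M /\ S *m a = b.
Proof.
move=> ab; have [->|anb] := eqVneq a b.
  by exists 1%:M; rewrite trmx1 !mul1mx.
pose w := a - b; pose q := (w^T *m w) 0 0.
have wE : w^T *m w = q%:M by rewrite [LHS]mx11_scalar.
have q0 : q != 0.
  apply: contraNneq anb => q0; rewrite -subr_eq0 -/w; apply/eqP.
  by apply: trmx_inj; rewrite trmx0; apply: mulmx_tr_eq0; rewrite trmxK wE q0 raddf0.
have baab : b^T *m a = a^T *m b 
  by rewrite -[LHS]trmxK trmx_mul trmxK [in LHS](mx11_scalar (a^T *m b)) tr_scalar_mx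
    -mx11_scalar.
have wa : w^T *m a = (q / 2)%:M.
  have : w^T *m w = 2 *: (w^T *m a).
    have wT : w^T = a^T - b^T by rewrite /w linearB.
    rewrite wT {1}/w !mulmxBl !mulmxBr baab -ab.
    move: (a^T *m a) (a^T *m b) => x y.
    by apply/matrixP => i j; rewrite !mxE; ring.
  rewrite wE => /(congr1 (fun M => 2^-1 *: M)); rewrite scalerA mulVf// scale1r => <-.
  by rewrite scale_scalar_mx mulrC.
pose S := 1%:M - (2 / q) *: (w *m w^T).
have ST : S^T = S by rewrite /S linearB linearZ /= trmx1 trmx_mul trmxK.
exists S; rewrite ST; split.
  rewrite /S mulmxBl mul1mx mulmxBr mulmx1 -?scalemxAl -?scalemxAr -?scalemxAl.
  rewrite mulmxA -[w *m w^T *m w]mulmxA wE mul_mx_scalar -scalemxAl !scalerA.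
  have -> : 2 / q * (2 / q * q) = 2 * (2 / q) by field.
  by move: (w *m w^T) => W; apply/matrixP => i j; rewrite !mxE; ring.
rewrite /S mulmxBl mul1mx -scalemxAl -mulmxA wa mul_mx_scalar scalerA.
have -> : 2 / q * (q / 2) = 1 by field.
by rewrite scale1r /w opprB addrC subrK.
Qed.

End Householder.

Section LorentzFrame.
Context {R : realType} {m : nat}.
Local Notation V := 'cV[R]_m.+2.

(* In the coordinates (X, Z, Y) the form is [|Y|^2 - 2 X Z], and the null
   vector [f] is the first basis vector. *)
Lemma lorentz_null_frame (f : V) : f != 0 -> f^T *m lorentz *m f = 0 ->
  exists (X Z : 'rV[R]_m.+2) (Y : 'M[R]_(m, m.+2)),
  [/\ lorentz = Y^T *m Y - X^T *m Z - Z^T *m X,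
      X *m f = 1%:M, Z *m f = 0 & Y *m f = 0].
Proof.
move=> f0 fJf.
pose L : 'rV[R]_m.+2 := delta_mx 0 ord_max.
(* [P] drops the last coordinate and [L] reads it: they give the space and time parts of a
   vector. *)
pose P : 'M[R]_(m.+1, m.+2) := \matrix_(i, j) (lift ord_max i == j)%:R.
have PL1 : P^T *m P + L^T *m L = 1%:M.
  apply/matrixP => i j; rewrite !mxE big_ord1 !mxE.
  under eq_bigr do rewrite !mxE.
  case: (unliftP ord_max i) => [k ->|->].
    rewrite (bigD1 k)//= eqxx mul1r big1 => [|l lk].
      by rewrite [lift _ _ == ord_max]eq_sym (negbTE (neq_lift _ _)) mul0r !addr0.
    by rewrite (inj_eq lift_inj) (negbTE lk) mul0r.
  rewrite big1 => [|l _]; first by rewrite !eqxx add0r mul1r eq_sym.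
  by rewrite [lift _ _ == ord_max]eq_sym (negbTE (neq_lift _ _)) mul0r.
have JE : lorentz = P^T *m P - L^T *m L.
  have LL : L^T *m L = delta_mx ord_max ord_max by rewrite trmx_delta mul_delta_mx.
  rewrite -[P^T *m P](addrK (L^T *m L)) PL1 LL.
  apply/matrixP => i j; rewrite !mxE.
  have [->|ij] := eqVneq i j; last first.
    rewrite mulr0n; case: (eqVneq i ord_max) => [im|]; last by rewrite subr0 subrr.
    by rewrite [j == _]eq_sym -im (negbTE ij) subr0 subrr.
  by case: eqVneq => _ /=; rewrite ?mulr1n; ring.
pose a := P *m f; pose z := (L *m f) 0 0.
have LfE : L *m f = z%:M by rewrite [LHS]mx11_scalar.
have aa : a^T *m a = (z ^+ 2)%:M.
  move: fJf; rewrite JE mulmxBr mulmxBl /a trmx_mul !mulmxA => /eqP.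
  rewrite subr_eq0 => /eqP ->.
  by rewrite -mulmxA LfE -trmx_mul LfE tr_scalar_mx -scalar_mxM.
have z0 : z != 0.
  apply: contraNneq f0 => z0.
  have a0 : a = 0.
    apply: trmx_inj; rewrite trmx0; apply: mulmx_tr_eq0.
    by rewrite trmxK aa z0 expr0n /= raddf0.
  by rewrite -[f]mul1mx -PL1 mulmxDl -!mulmxA -/a a0 LfE z0 !raddf0 addr0.
(* Since [f] is null, its space part [a] has the length of its time part [z], so a reflection turns
   [a] into (z, 0, ..., 0). *)
pose b : 'cV[R]_(1 + m) := col_mx z%:M 0.
have bb : b^T *m b = (z ^+ 2)%:M.
  rewrite /b tr_col_mx mul_row_col trmx0 mul0mx addr0 tr_scalar_mx.
  by rewrite -scalar_mxM.
have [|S [SS Sa]] := @reflection_exists R _ a b.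
  by rewrite aa bb.
pose S0 := usubmx (S : 'M[R]_(1 + m, m.+1)); pose S1 := dsubmx (S : 'M[R]_(1 + m, m.+1)).
have SE : S = col_mx S0 S1 by rewrite vsubmxK.
have Sa2 : S0 *m a = z%:M /\ S1 *m a = 0.
  have : col_mx (S0 *m a) (S1 *m a) = b by rewrite -mul_col_mx -SE.
  by move=> /eq_col_mx[].
have S2 : S0^T *m S0 + S1^T *m S1 = 1%:M.
  have <- : (col_mx S0 S1)^T *m col_mx S0 S1 = S0^T *m S0 + S1^T *m S1.
    by rewrite tr_col_mx mul_row_col.
  by rewrite -SE.
pose xi := S0 *m P; pose Y := S1 *m P.
(* xi + L and xi - L are null coordinates; both [xi] and [L] take the value [z] at [f], whence the
   normalizing factors. *)
exists ((2 * z)^-1 *: (xi + L)), (- z *: (xi - L)), Y.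
have -> : lorentz = xi^T *m xi + Y^T *m Y - L^T *m L.
  rewrite JE; congr (_ - _); rewrite -[X in X *m P]mulmx1 -S2 mulmxDr mulmxDl.
  by rewrite /xi /Y !trmx_mul !mulmxA.
split.
- have -> : ((2 * z)^-1 *: (xi + L))^T = (2 * z)^-1 *: (xi^T + L^T).
    by rewrite linearZ /= linearD.
  have -> : (- z *: (xi - L))^T = - z *: (xi^T - L^T) by rewrite linearZ /= linearB.
  rewrite -!scalemxAl -!scalemxAr !mulmxDl !mulmxDr !mulNmx !mulmxN.
  move: (xi^T *m xi) (xi^T *m L) (L^T *m xi) (L^T *m L) (Y^T *m Y) => x1 x2 x3 x4 x5.
  by apply/matrixP => i j; rewrite !mxE; field.
- rewrite -scalemxAl mulmxDl LfE /xi -mulmxA -/a Sa2.1.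
  by apply/matrixP => i j; rewrite !mxE !ord1 /= !mulr1n; field.
- by rewrite -scalemxAl mulmxBl LfE /xi -mulmxA -/a Sa2.1 subrr scaler0.
- by rewrite /Y -mulmxA Sa2.2.
Qed.

End LorentzFrame.

(** * Bounded parts of discrete matrix groups are finite *)

Lemma finite_bounded_int_mx n (K : nat) :
  finite_set [set M : 'M[int]_n | forall i j, `|M i j| <= K%:Z].
Proof.
pose f (N : 'M['I_(K + K).+1]_n) : 'M[int]_n := \matrix_(i, j) (Posz (N i j) - K%:Z).
apply: (@sub_finite_set _ _ (f @` setT)); last exact: finite_image.
move=> M HM; exists (\matrix_(i, j) inord (absz (M i j + K%:Z))) => //.
apply/matrixP => i j; rewrite !mxE.
have := HM i j; rewrite ler_norml => /andP[h1 h2].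
have h0 : 0 <= M i j + K%:Z by rewrite -lerBlDr sub0r.
have hE : (absz (M i j + K%:Z))%:Z = M i j + K%:Z by rewrite gez0_abs.
rewrite inordK ?hE ?addrK//.
by rewrite ltnS -lez_nat hE PoszD lerD2r.
Qed.

Section DiscreteBounded.
Context {R : realType} {n : nat}.

(* Rounding the entries to a fine grid is injective on bounded subsets. *)
Lemma discrete_bounded_finite (G : set 'M[R]_n.+1) (r : R) :
  is_subgroup G -> discrete_subset G ->
  finite_set [set A | [/\ G A, `|A| <= r & `|invmx A| <= r]].
Proof.
move=> [Gu G1 GM GV] dG.
have [_ [U U1 UG]] := dG _ G1.
have /nbhs_ballP[e /= e0 he] := U1.
pose c : R := n.+1%:R * (`|r| + 1).
have c0 : 0 < c by rewrite mulr_gt0// ltr_wpDl.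
(* With this mesh, two elements that round alike have a quotient within c d = e/2 of the identity,
   hence equal to the isolated point 1. *)
pose d := e / (2 * c).
have d0 : 0 < d by rewrite divr_gt0// mulr_gt0.
pose f (A : 'M[R]_n.+1) : 'M[int]_n.+1 := \matrix_(i, j) Num.floor (A i j / d).
have fle (A : 'M[R]_n.+1) i j : 0 <= A i j - (f A i j)%:~R * d < d.
  rewrite mxE subr_ge0 ltrBlDr.
  have /andP[h1 h2] := Num.Theory.floor_itv (A i j / d).
  rewrite -ler_pdivlMr// h1/= -[X in X + _]mul1r -mulrDl -ltr_pdivrMr//.
  by rewrite addrC -intrD1.
set S := [set A | _].
have finj : {in S &, injective f}.
  move=> A B /set_mem[GA Ar _] /set_mem[GB Br BVr] fAB.
  have AB : `|B - A| <= d.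
    apply: mx_norm_le => [|i j]; first exact: ltW.
    have := fle A i j; have := fle B i j; rewrite fAB !mxE.
    move=> /andP[? ?] /andP[? ?]; rewrite ler_norml; lra.
  have : [set 1%:M] (A *m invmx B).
    rewrite -UG; split; last by apply: GM => //; exact: GV.
    apply: he; rewrite -ball_normE /= -(mulmxV (Gu _ GB)) -mulmxBl.
    rewrite (le_lt_trans (mx_norm_mul _ _))//.
    have h : n.+1%:R * `|B - A| * `|invmx B| <= c * d.
      rewrite mulrAC /c ler_pM// ?mulr_ge0// ler_wpM2l//.
      by rewrite (le_trans BVr)// (le_trans (ler_norm _))// lerDl.
    rewrite (le_lt_trans h)// (_ : c * d = e / 2); last by rewrite /d; field; rewrite gt_eqF.
    by rewrite ltr_pdivrMr// ltr_pMr// ltr1n.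
  by move/(congr1 (mulmx^~ B)); rewrite mulmxKV ?mul1mx//; exact: Gu.
pose K := Num.bound ((`|r| / d) + 1).
have fS A : S A -> forall i j, `|f A i j| <= K%:Z.
  move=> [_ Ar _] i j.
  have h : `|(f A i j)%:~R : R| * d <= `|r| + d.
    have /andP[h1 h2] := fle A i j.
    have h3 : `|A i j| <= `|r|.
      by rewrite (le_trans (mx_entry_le _ _ _))// (le_trans Ar)// ler_norm.
    rewrite -[X in _ * X]gtr0_norm// -normrM.
    by move: h3; rewrite !ler_norml => /andP[? ?]; apply/andP; lra.
  rewrite -ler_pdivlMr// mulrDl divff ?gt_eqF// in h.
  rewrite -(ler_int R) intr_norm (le_trans h)//.
  by rewrite -pmulrn ltW// archi_boundP// addr_ge0// divr_ge0// ltW.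
have : finite_set (f @` S).
  apply: sub_finite_set (finite_bounded_int_mx n.+1 K).
  by move=> _ [A SA <-]; exact: fS.
by rewrite (eq_finite_set (inj_card_eq finj)).
Qed.

End DiscreteBounded.

Section FrameInverse.
Context {R : realType} {m : nat}.
Local Notation V := 'cV[R]_m.+2.
Variables (Q : 'M[R]_m.+2) (f : V) (X Z : 'rV[R]_m.+2) (Y : 'M[R]_(m, m.+2)).
Hypothesis QE : Q = Y^T *m Y - X^T *m Z - Z^T *m X.
Hypothesis Qu : Q \in unitmx.
Hypotheses (Xf : X *m f = 1%:M) (Zf : Z *m f = 0) (Yf : Y *m f = 0).

(** The rows X, Z, Y form an invertible matrix, being a factor of [Q]. Its inverse has [f] as first
    column; [x] is the second column and [P] collects the others. *)
Lemma frame_inverse : exists (x : V) (P : 'M[R]_(m.+2, m)),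
  [/\ f *m X + x *m Z + P *m Y = 1%:M,
      X *m x = 0, Z *m x = 1%:M & Y *m x = 0] /\
  [/\ X *m P = 0, Z *m P = 0 & Y *m P = 1%:M].
Proof.
pose F : 'M[R]_(1 + (1 + m), m.+2) := col_mx X (col_mx Z Y).
pose E : 'M[R]_(m.+2, 1 + (1 + m)) := row_mx (- Z^T) (row_mx (- X^T) Y^T).
have EF : Q = E *m F.
  rewrite /E /F !mul_row_col QE !mulNmx.
  by apply/matrixP => i j; rewrite !mxE; ring.
have uF : (F : 'M[R]_m.+2) \in unitmx by move: Qu; rewrite EF unitmx_mul => /andP[].
pose I := (invmx (F : 'M[R]_m.+2)) : 'M[R]_(m.+2, 1 + (1 + m)).
have FI : F *m I = 1%:M by exact: (mulmxV uF).
have IF : I *m F = 1%:M by exact: (mulVmx uF).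
pose e0 : 'cV[R]_(1 + (1 + m)) := col_mx 1%:M (col_mx 0 0).
pose e1 : 'cV[R]_(1 + (1 + m)) := col_mx 0 (col_mx 1%:M 0).
pose e2 : 'M[R]_(1 + (1 + m), m) := col_mx 0 (col_mx 0 1%:M).
have fE : f = I *m e0.
  by rewrite -[LHS]mul1mx -IF -mulmxA /F !mul_col_mx Xf Zf Yf.
have FIe (k : nat) (e : 'M[R]_(1 + (1 + m), k)) : F *m (I *m e) = e.
  by rewrite mulmxA FI mul1mx.
exists (I *m e1), (I *m e2); split; last first.
  by have := FIe _ e2; rewrite {1}/F !mul_col_mx => /eq_col_mx[-> /eq_col_mx[-> ->]].
have := FIe _ e1; rewrite {1}/F !mul_col_mx => /eq_col_mx[-> /eq_col_mx[-> ->]].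
split => //.
rewrite fE -!mulmxA -!mulmxDr -IF; congr (_ *m _).
by rewrite !mul_col_mx !mul1mx !mul0mx !add_col_mx !addr0 !add0r.
Qed.

End FrameInverse.

(** * The stabilizer of a null vector as a group of Euclidean isometries *)

Section ParabolicGroup.
Context {R : realType} {m : nat}.
Local Notation V := 'cV[R]_m.+2.
Variables (Q : 'M[R]_m.+2) (f x : V) (X Z : 'rV[R]_m.+2).
Variables (Y : 'M[R]_(m, m.+2)) (P : 'M[R]_(m.+2, m)).
Hypothesis QE : Q = Y^T *m Y - X^T *m Z - Z^T *m X.
Hypotheses (Xf : X *m f = 1%:M) (Zf : Z *m f = 0) (Yf : Y *m f = 0).
Hypothesis frame1 : f *m X + x *m Z + P *m Y = 1%:M.
Hypotheses (Xx : X *m x = 0) (Zx : Z *m x = 1%:M) (Yx : Y *m x = 0).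
Hypotheses (XP : X *m P = 0) (ZP : Z *m P = 0) (YP : Y *m P = 1%:M).

Let fQ : f^T *m Q = - Z.
Proof.
rewrite QE !mulmxBr !mulmxA -!trmx_mul Xf Zf Yf !trmx0 !mul0mx trmx1 mul1mx.
by rewrite subr0 sub0r.
Qed.

Let xQ : x^T *m Q = - X.
Proof.
rewrite QE !mulmxBr !mulmxA -!trmx_mul Xx Zx Yx !trmx0 !mul0mx trmx1 mul1mx.
by rewrite subr0 sub0r.
Qed.

Let QP : Q *m P = Y^T.
Proof. by rewrite QE !mulmxBl -!mulmxA XP ZP YP !mulmx0 mulmx1 !subr0. Qed.

(* The stabilizer of [f] acts on the affine space [Z = 1] modulo [f] by Euclidean
   isometries; these are the linear and the translation part. *)
Definition par_rot (A : 'M[R]_m.+2) := Y *m A *m P.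
Definition par_tr (A : 'M[R]_m.+2) := Y *m A *m x.

Section Element.
Variable A : 'M[R]_m.+2.
Hypotheses (AQ : A^T *m Q *m A = Q) (Af : A *m f = f).

(** -Z is the functional that [Q] pairs with [f], and [A] preserves both. *)
Lemma par_ZE : Z *m A = Z.
Proof.
apply: oppr_inj; rewrite -mulNmx -fQ -[in LHS]Af trmx_mul -!mulmxA.
by rewrite [A^T *m _]mulmxA AQ.
Qed.

Lemma par_YE : Y *m A = par_rot A *m Y + par_tr A *m Z.
Proof.
rewrite -[LHS]mulmx1 -frame1 !mulmxDr [_ *m (f *m X)]mulmxA -[_ *m f]mulmxA Af Yf.
by rewrite mul0mx add0r addrC !mulmxA.
Qed.

(** [A] preserves the kernel of [Z], on which [Q] restricts to the squared norm of the [Y]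
    coordinates. *)
Lemma par_rot_orth : (par_rot A)^T *m par_rot A = 1%:M.
Proof.
have YY : Y^T *m Y = Q + X^T *m Z + Z^T *m X.
  by rewrite QE; apply/matrixP => i j; rewrite !mxE; ring.
have ZAP : Z *m (A *m P) = 0 by rewrite mulmxA par_ZE.
rewrite /par_rot -!mulmxA trmx_mul -mulmxA [Y^T *m _]mulmxA YY !mulmxDl !mulmxDr.
rewrite -[X^T *m Z *m _]mulmxA ZAP !mulmx0 addr0.
rewrite [_ *m (Z^T *m X *m _)]mulmxA [_ *m (Z^T *m X)]mulmxA -trmx_mul ZAP trmx0 !mul0mx addr0.
by rewrite trmx_mul -!mulmxA [A^T *m _]mulmxA [A^T *m Q *m _]mulmxA AQ QP -trmx_mul YP trmx1.
Qed.

End Element.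

Section Pair.
Variables A B : 'M[R]_m.+2.
Hypotheses (AQ : A^T *m Q *m A = Q) (Af : A *m f = f).
Hypotheses (BQ : B^T *m Q *m B = Q) (Bf : B *m f = f).

Lemma par_rotM : par_rot (A *m B) = par_rot A *m par_rot B.
Proof.
rewrite {1}/par_rot mulmxA par_YE// !mulmxDl -[_ *m Z *m B]mulmxA (par_ZE BQ Bf).
by rewrite -[_ *m Z *m P]mulmxA ZP mulmx0 addr0 /par_rot !mulmxA.
Qed.

Lemma par_trM : par_tr (A *m B) = par_rot A *m par_tr B + par_tr A.
Proof.
rewrite {1}/par_tr mulmxA par_YE// !mulmxDl -[_ *m Z *m B]mulmxA (par_ZE BQ Bf).
by rewrite -[_ *m Z *m x]mulmxA Zx mulmx1 /par_tr !mulmxA.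
Qed.

(* The X-row of A is forced by the invariance of Q, and can be read off the
   translation parts of A and of its inverse B. *)
Lemma par_mxE : A *m B = 1%:M -> A =
  f *m X + (x + P *m par_tr A + 2^-1 *: (f *m ((par_tr A)^T *m par_tr A))) *m Z
  + (P *m par_rot A - f *m (par_tr B)^T) *m Y.
Proof.
move=> AB.
have QA : Q *m A = B^T *m Q.
  by rewrite -[LHS]mul1mx -trmx1 -AB trmx_mul -!mulmxA [A^T *m _]mulmxA AQ.
have XAP : X *m A *m P = - (par_tr B)^T.
  rewrite -[X]opprK -xQ !mulNmx -!mulmxA; congr (- _).
  by rewrite [Q *m _]mulmxA QA -mulmxA QP /par_tr -!trmx_mul.
(* A x is null like [x], and its [Z] coordinate is 1, so twice its [X] coordinate is the squared
   norm of its [Y] part. *)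
have XAx : X *m A *m x = 2^-1 *: ((par_tr A)^T *m par_tr A).
  have xQx : x^T *m Q *m x = 0 by rewrite xQ mulNmx Xx oppr0.
  have : (A *m x)^T *m Q *m (A *m x) = 0.
    by rewrite trmx_mul -xQx -!mulmxA [A^T *m _]mulmxA [A^T *m Q *m _]mulmxA AQ.
  have ZAx : Z *m (A *m x) = 1%:M by rewrite mulmxA par_ZE.
  rewrite /par_tr -!mulmxA; move: (A *m x) ZAx => v Zv.
  rewrite QE !mulmxBl !mulmxBr !mulmxA -!trmx_mul.
  rewrite -[_ *m Y *m v]mulmxA -[_ *m Z *m v]mulmxA -[_ *m X *m v]mulmxA Zv.
  rewrite trmx1 mulmx1 mul1mx [X *m v]mx11_scalar tr_scalar_mx.
  move: ((Y *m _)^T *m _) => t; set s := (_ 0 0)%:M => /eqP.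
  rewrite -addrA -opprD subr_eq0 => /eqP ->.
  by apply/matrixP => i j; rewrite !mxE; field.
have ZA := par_ZE AQ Af.
have XA : X *m A = X + 2^-1 *: ((par_tr A)^T *m par_tr A) *m Z - (par_tr B)^T *m Y.
  rewrite -[LHS]mulmx1 -frame1 !mulmxDr [_ *m (f *m X)]mulmxA -[_ *m f]mulmxA Af Xf.
  by rewrite mul1mx ![X *m A *m (_ *m _)]mulmxA XAx XAP mulNmx.
rewrite -[LHS]mul1mx -frame1 !mulmxDl -!mulmxA XA ZA (par_YE Af).
rewrite !mulmxDr ?mulmxDl ?mulmxN ?mulNmx -?scalemxAl -?scalemxAr -?scalemxAl -?mulmxA.
move: (f *m X) (f *m _) (f *m _) (x *m Z) (P *m _) (P *m _) => y1 y2 y3 y4 y5 y6.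
by apply/matrixP => i j; rewrite !mxE; ring.
Qed.

End Pair.
End ParabolicGroup.

Section BoundedFamily.
Context {R : realType} {T : Type}.

(** Allows a matrix formula to be bounded term by term, without explicit constants. *)
Definition bounded_family m n (F : T -> 'M[R]_(m, n)) : Prop :=
  exists K : R, forall i, `|F i| <= K.

Lemma bounded_cst m n (A : 'M[R]_(m, n)) : bounded_family (fun=> A).
Proof. by exists `|A|. Qed.

Lemma bounded_add m n (F G : T -> 'M[R]_(m, n)) :
  bounded_family F -> bounded_family G -> bounded_family (fun i => F i + G i).
Proof.
by move=> [K HK] [L HL]; exists (K + L) => i; rewrite (le_trans (ler_normD _ _))// lerD.
Qed.

Lemma bounded_opp m n (F : T -> 'M[R]_(m, n)) :
  bounded_family F -> bounded_family (fun i => - F i).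
Proof. by move=> [K HK]; exists K => i; rewrite normrN. Qed.

Lemma bounded_scale m n a (F : T -> 'M[R]_(m, n)) :
  bounded_family F -> bounded_family (fun i => a *: F i).
Proof. by move=> [K HK]; exists (`|a| * K) => i; rewrite normrZ ler_wpM2l. Qed.

Lemma bounded_tr m n (F : T -> 'M[R]_(m, n)) :
  bounded_family F -> bounded_family (fun i => (F i)^T).
Proof. by move=> [K HK]; exists K => i; rewrite mx_norm_tr. Qed.

Lemma bounded_mul m n k (F : T -> 'M[R]_(m, n)) (G : T -> 'M[R]_(n, k)) :
  bounded_family F -> bounded_family G -> bounded_family (fun i => F i *m G i).
Proof.
move=> [K HK] [L HL]; exists (n%:R * K * L) => i.
by rewrite (le_trans (mx_norm_mul _ _))// ler_pM// ?mulr_ge0// ler_wpM2l.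
Qed.

End BoundedFamily.

(** * Coboundedness of a discrete Z^m that fixes a null vector *)

Section ParabolicLattice.
Context {R : realType} {m : nat}.
Local Notation V := 'cV[R]_m.+2.
Variables (Q : 'M[R]_m.+2) (f x : V) (X Z : 'rV[R]_m.+2).
Variables (Y : 'M[R]_(m, m.+2)) (P : 'M[R]_(m.+2, m)).
Hypothesis QE : Q = Y^T *m Y - X^T *m Z - Z^T *m X.
Hypotheses (Xf : X *m f = 1%:M) (Zf : Z *m f = 0) (Yf : Y *m f = 0).
Hypothesis frame1 : f *m X + x *m Z + P *m Y = 1%:M.
Hypotheses (Xx : X *m x = 0) (Zx : Z *m x = 1%:M) (Yx : Y *m x = 0).
Hypotheses (XP : X *m P = 0) (ZP : Z *m P = 0) (YP : Y *m P = 1%:M).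
Variables (S : set 'M[R]_m.+2) (h : 'rV[int]_m -> 'M[R]_m.+2).
Hypotheses (Sgrp : is_subgroup S) (Sdisc : discrete_subset S).
Hypotheses (SQ : forall A, S A -> A^T *m Q *m A = Q).
Hypotheses (Sf : forall A, S A -> A *m f = f).
Hypotheses (hS : forall a, S (h a)) (hinj : injective h).
Hypothesis hD : forall a b, h (a + b) = h a *m h b.

Local Notation prot := (par_rot Y P).
Local Notation ptr := (par_tr x Y).

Let hQ a : (h a)^T *m Q *m h a = Q. Proof. exact: SQ. Qed.
Let hf a : h a *m f = f. Proof. exact: Sf. Qed.

Let rotM a b : prot (h (a + b)) = prot (h a) *m prot (h b).
Proof. by rewrite hD (par_rotM QE Xf Zf Yf frame1 ZP). Qed.

Let trM a b : ptr (h (a + b)) = prot (h a) *m ptr (h b) + ptr (h a).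
Proof. by rewrite hD (par_trM QE Xf Zf Yf frame1 Zx). Qed.

Let rot_orth a : (prot (h a))^T *m prot (h a) = 1%:M.
Proof. exact: (par_rot_orth QE Xf Zf Yf XP ZP YP). Qed.

Let rot_le1 a : `|prot (h a)| <= 1.
Proof.
by rewrite -mx_norm_tr orthogonal_norm_le// trmxK rot_orth.
Qed.

Let h0 : h 0 = 1%:M.
Proof.
have [Su _ _ _] := Sgrp; have := hD 0 0; rewrite addr0.
by move=> /(congr1 (mulmx (invmx (h 0)))); rewrite mulKmx ?mulVmx//; exact: Su.
Qed.

Let hNK a : h a *m h (- a) = 1%:M. Proof. by rewrite -hD subrr h0. Qed.

Let tr_opp a : ptr (h (- a)) = - (prot (h (- a)) *m ptr (h a)).
Proof.
have := trM (- a) a; rewrite addNr h0 /par_tr mulmx1 Yx => /esym/eqP.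
by rewrite addrC addr_eq0 => /eqP.
Qed.

Let tr_opp_le a : `|ptr (h (- a))| <= m%:R * 1 * `|ptr (h a)|.
Proof.
by rewrite tr_opp normrN (le_trans (mx_norm_mul _ _))// ler_wpM2r// ler_wpM2l.
Qed.

(** By [par_mxE], a bounded translation part bounds [h a] and its inverse, and discreteness leaves
    finitely many such elements. *)
Let proper r : finite_set [set a | `|(ptr (h a))^T| <= r].
Proof.
pose T := {a | `|ptr (h a)| <= r}.
have bt : bounded_family (fun a : T => ptr (h (sval a))) by exists r; case.
have btN : bounded_family (fun a : T => ptr (h (- sval a))).
  exists (m%:R * 1 * r) => -[a ar] /=.
  by rewrite (le_trans (tr_opp_le _))// ler_wpM2l ?mulr_ge0.
have br : bounded_family (fun a : T => prot (h (sval a))) by exists 1.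
have brN : bounded_family (fun a : T => prot (h (- sval a))) by exists 1.
have [K HK] : bounded_family (fun a : T => h (sval a)).
  have [K HK] : bounded_family (fun a : T => f *m X +
      (x + P *m ptr (h (sval a)) +
        2^-1 *: (f *m ((ptr (h (sval a)))^T *m ptr (h (sval a))))) *m Z +
      (P *m prot (h (sval a)) - f *m (ptr (h (- sval a)))^T) *m Y).
    by do ![assumption | apply: bounded_add | apply: bounded_opp | apply: bounded_scale |
      apply: bounded_mul | apply: bounded_tr | apply: bounded_cst].
  exists K => a.
  by rewrite (par_mxE QE Xf Zf Yf frame1 Xx Zx Yx XP ZP YP _ _ (hNK (sval a))).
have [L HL] : bounded_family (fun a : T => h (- sval a)).
  have [L HL] : bounded_family (fun a : T => f *m X +
      (x + P *m ptr (h (- sval a)) +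
        2^-1 *: (f *m ((ptr (h (- sval a)))^T *m ptr (h (- sval a))))) *m Z +
      (P *m prot (h (- sval a)) - f *m (ptr (h (sval a)))^T) *m Y).
    by do ![assumption | apply: bounded_add | apply: bounded_opp | apply: bounded_scale |
      apply: bounded_mul | apply: bounded_tr | apply: bounded_cst].
  exists L => a; have e : h (- sval a) *m h (sval a) = 1%:M by rewrite -hD addNr h0.
  by rewrite (par_mxE QE Xf Zf Yf frame1 Xx Zx Yx XP ZP YP _ _ e).
have fin := discrete_bounded_finite (Num.max K L) Sgrp Sdisc.
apply: sub_finite_set (finite_preimage (in2W hinj) fin) => a /=.
rewrite mx_norm_tr => ar; split => //.
  by rewrite le_max (HK (exist _ a ar)).
have -> : invmx (h a) = h (- a).
  have [Su _ _ _] := Sgrp.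
  by rewrite -[LHS]mulmx1 -(hNK a) mulKmx//; exact: Su.
by rewrite le_max (HL (exist _ a ar)) orbT.
Qed.

Let dense : exists M : R, forall y : 'cV[R]_m, exists a, `|y - ptr (h a)| <= M.
Proof.
(* Transposing turns the left action on columns into a right action on rows; it reverses products,
   and [addrC] restores their order. *)
have [|||M HM] := @cobounded_isometries R m (fun a => (prot (h a))^T)
  (fun a => (ptr (h a))^T) _ _ _ proper.
- by move=> a; rewrite trmxK rot_orth.
- by move=> a b; rewrite addrC rotM trmx_mul.
- by move=> a b; rewrite addrC trM linearD /= trmx_mul.
exists M => y; have [a ha] := HM y^T; exists a.
by rewrite -mx_norm_tr linearB.
Qed.

Let frame_decomp v : v = (X *m v) 0 0 *: f + (Z *m v) 0 0 *: x + P *m (Y *m v).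
Proof.
rewrite -[LHS]mul1mx -frame1 !mulmxDl -!mulmxA.
by rewrite {1}[X *m v]mx11_scalar {1}[Z *m v]mx11_scalar !mul_mx_scalar.
Qed.

Let Yh a v : Y *m (h a *m v) = prot (h a) *m (Y *m v) + (Z *m v) 0 0 *: ptr (h a).
Proof.
rewrite mulmxA (par_YE Yf frame1 (hf a)) mulmxDl.
rewrite -[prot _ *m Y *m v]mulmxA -[ptr _ *m Z *m v]mulmxA.
by rewrite {1}[Z *m v]mx11_scalar mul_mx_scalar.
Qed.

Let Zh a (v : V) : Z *m (h a *m v) = Z *m v.
Proof. by rewrite mulmxA (par_ZE QE Xf Zf Yf (hQ a) (hf a)). Qed.

(** Take [a] whose translation part is near Y v: then h(-a) brings [v] to a bounded [Y] coordinate,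
    and a multiple of [f] cancels the [X] coordinate. *)
Lemma lattice_cobounded1 : exists M : R, forall v,
  linform Z v = 1 -> exists A s, S A /\ `|A *m v + s *: f| <= M.
Proof.
have [M HM] := dense; exists (`|x| + m%:R * `|P| * (m%:R * 1 * M)) => v v1.
have [a ha] := HM (Y *m v).
exists (h (- a)), (- (X *m (h (- a) *m v)) 0 0); split => //.
set w := h (- a) *m v.
have -> : w + - (X *m w) 0 0 *: f = x + P *m (Y *m w).
  have Zw : (Z *m w) 0 0 = 1 by rewrite /w Zh.
  rewrite {1}[w]frame_decomp Zw scale1r.
  by rewrite scaleNr addrC !addrA addNr add0r.
rewrite (le_trans (ler_normD _ _))// lerD// (le_trans (mx_norm_mul _ _))//.
rewrite ler_wpM2l ?mulr_ge0// /w Yh (v1 : (Z *m v) 0 0 = 1) scale1r tr_opp -mulmxBr.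
by rewrite (le_trans (mx_norm_mul _ _))// ler_pM ?mulr_ge0// ler_wpM2l.
Qed.

Lemma lattice_cobounded2 y : linform Z y = 1 -> exists M : R, forall v,
  linform Z v = 1 -> exists A s, S A /\ `|v - A *m y + s *: f| <= M.
Proof.
move=> y1; have [M HM] := dense.
exists (m%:R * `|P| * (M + m%:R * 1 * `|Y *m y|)) => v v1.
have [a ha] := HM (Y *m v).
set w := v - h a *m y.
exists (h a), (- (X *m w) 0 0); split => //.
have -> : w + - (X *m w) 0 0 *: f = P *m (Y *m w).
  have Zw : (Z *m w) 0 0 = 0.
    have := linformB Z v (h a *m y); rewrite v1 /linform Zh -/(linform Z y) y1 subrr.
    by [].
  rewrite {1}[w]frame_decomp Zw scale0r addr0.
  by rewrite scaleNr addrC !addrA addNr add0r.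
rewrite (le_trans (mx_norm_mul _ _))// ler_wpM2l ?mulr_ge0//.
rewrite /w mulmxBr Yh (y1 : (Z *m y) 0 0 = 1) scale1r opprD addrA addrAC.
rewrite (le_trans (ler_normB _ _))// lerD//.
by rewrite (le_trans (mx_norm_mul _ _))// ler_wpM2r// ler_wpM2l.
Qed.

End ParabolicLattice.

Section ConjugateIntoPO.
Context {R : realType} {n : nat}.

Lemma det_lorentz_neq0 : \det (@lorentz R n) != 0.
Proof.
rewrite /lorentz det_diag; apply/prodf_neq0 => i _; rewrite mxE.
by case: ifP => _; rewrite ?oppr_eq0 oner_eq0.
Qed.

(* Since the determinants are +-1, the scalar in the conjugacy is +-1 too. *)
Lemma PO_invariant_form (S : set 'M[R]_n.+1) :
  (forall A, S A -> `|\det A| = 1) -> conjugate_into_PO S ->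
  exists2 g : 'M[R]_n.+1, g \in unitmx &
    forall A, S A -> A^T *m (g^T *m lorentz *m g) *m A = g^T *m lorentz *m g.
Proof.
move=> Sdet [g gu Sg]; exists g => // A SA; have [c c0] := Sg A SA.
set B := g *m A *m invmx g; rewrite /O_n1 /= => BJ.
have gdet : \det g != 0 by rewrite -unitfE -unitmxE.
have dB : `|\det B| = 1.
  by rewrite /B !det_mulmx det_inv mulrAC mulfV// mul1r Sdet.
have c2 : c ^+ 2 = 1.
  move: BJ => /(congr1 determinant); rewrite !det_mulmx det_tr detZ.
  rewrite mulrAC -[RHS]mul1r => /(mulIf det_lorentz_neq0).
  move=> /(congr1 Num.norm); rewrite !normrM dB mulr1 normr1 -expr2 normrX -!exprM mulnC exprM.
  move/eqP; rewrite pexpr_eq1 ?sqr_ge0//.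
  by rewrite real_normK ?num_real// => /eqP.
have {}BJ : B^T *m lorentz *m B = lorentz.
  have cBT : (c *: B)^T = c *: B^T by rewrite linearZ.
  by move: BJ; rewrite cBT -!scalemxAl -scalemxAr scalerA -expr2 c2 scale1r.
have Bg : B *m g = g *m A by rewrite /B mulmxKV.
have -> : A^T *m (g^T *m lorentz *m g) *m A = (g *m A)^T *m lorentz *m (g *m A).
  by rewrite trmx_mul !mulmxA.
by rewrite -Bg -[in RHS]BJ trmx_mul !mulmxA.
Qed.

End ConjugateIntoPO.

(** * Dynamics of the cusp group for n at least 2 *)

Section ParabolicCobounded.
Context {R : realType} {m : nat}.
Local Notation V := 'cV[R]_m.+3.
Variables (C D : set V) (S : set 'M[R]_m.+3).
Variables (phi psi : 'rV[R]_m.+3) (c : R) (p : V).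
Hypotheses (oC : open_convex_cone C) (oD : open_convex_cone D) (DC : D `<=` C).
Hypotheses (c0 : 0 < c) (Cphi : forall v, C v -> c * `|v| <= linform phi v).
Hypotheses (Sgrp : is_subgroup S) (Sdisc : discrete_subset S).
Hypothesis Sdet : forall A, S A -> `|\det A| = 1.
Hypothesis SC : forall A v, S A -> C v -> C (A *m v).
Hypothesis Sp : forall A, S A -> A *m p = p.
Hypothesis Spsi : forall A, S A -> psi *m A = psi.
Hypothesis SD : forall A v, S A -> D v -> D (A *m v).
Hypothesis D0 : D !=set0.
Hypotheses (p0 : p != 0) (phip : 0 < linform phi p).
Hypothesis psiC : forall v, C v -> 0 < linform psi v.
Hypothesis psip : linform psi p = 0.
Hypothesis psi_ker : forall v, closure C v -> linform psi v = 0 ->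
  exists t, v = t *: p.
Hypothesis SPO : conjugate_into_PO S.
Hypothesis SZ : virtually_Zk m.+1 S.

(** [S] contains an infinite group Z^(m+1), closed under inverses, and discreteness allows only
    finitely many elements bounded with their inverses. *)
Let unbounded r : exists2 A, S A & r < `|A|.
Proof.
apply/not_exists2P => H.
have [h [hS hinj hD _]] := SZ; have [Su _ _ _] := Sgrp.
have h0 : h 0 = 1%:M.
  have := hD 0 0; rewrite addr0.
  by move=> /(congr1 (mulmx (invmx (h 0)))); rewrite mulKmx ?mulVmx//; exact: Su.
have hV a : invmx (h a) = h (- a).
  rewrite -[LHS]mulmx1 -h0 -(subrr a) hD mulKmx//; exact: Su.
have hr a : `|h a| <= r by have [//|/negP] := H (h a); rewrite -leNgt.
have : finite_set [set: 'rV[int]_m.+1].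
  apply: sub_finite_set (finite_preimage (in2W hinj) (discrete_bounded_finite r Sgrp Sdisc)).
  by move=> a _ /=; split; rewrite ?hV.
have ci : injective (fun k : nat => const_mx (Posz k) : 'rV[int]_m.+1).
  by move=> k l /matrixP/(_ 0 0); rewrite !mxE => -[].
move=> /(finite_preimage (in2W ci)); rewrite preimage_setT.
exact: infinite_nat.
Qed.

(* Since psi is invariant and vanishes only at p, a divergent orbit can only
   accumulate projectively at p. *)
Lemma parabolic_orbit_limit x e : D x -> 0 < e -> exists A s,
  [/\ S A, 0 < s, s < e, `|s *: (A *m x)| = 1 & `| `|p|^-1 *: p - s *: (A *m x)| < e].
Proof.
move=> Dx e0; have np : 0 < `|p| by rewrite normr_gt0.
have np' : `|p| != 0 by rewrite gt_eqF.
have cpsi v : closure C v -> 0 <= linform psi v.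
  move=> clv; have H u : C u -> 0 * `|u| <= linform psi u.
    by rewrite mul0r => /psiC/ltW.
  by have := linform_closure_ge H clv; rewrite mul0r.
(* The unit directions of the closed cone that are far from [p] form a compact set, on which [psi]
   has a positive lower bound [k]. *)
pose F := [set w : V | [/\ closure C w, `|w| = 1 & e <= `| `|p|^-1 *: p - w|]].
have cF : closed F.
  have -> : F = closure C `&`
      ([set w : V | `|w| = 1] `&` [set w : V | e <= `| `|p|^-1 *: p - w|]).
    by apply/seteqP; split => w [? H]; [move=> ?|case: H].
  apply: closedI; first exact: closed_closure.
  apply: closedI.
    apply: (@preimage_closed _ _ (fun z : V => `|z|) [set 1]); last exact: closed_eq.
    by move=> ? _; exact: norm_continuous.
  have -> : [set w : V | e <= `| `|p|^-1 *: p - w|] = ~` ball (`|p|^-1 *: p) e.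
    by apply/seteqP; split => w; rewrite -ball_normE /= leNgt => /negP.
  exact/open_closedC/ball_open.
have [|w [clw w1 we]|k k0 Fk] := @compact_linform_gt0 _ _ psi F 1 cF.
- by move=> v [_ -> _].
- rewrite lt_neqAle cpsi// andbT eq_sym; apply/eqP => psiw.
  have [t wt] := psi_ker clw psiw.
  have t0 : 0 <= t.
    have H := linform_closure_ge Cphi clw; rewrite -(pmulr_lge0 _ phip) -linformZ -wt.
    by rewrite (le_trans _ H)// w1 mulr1 ltW.
  have tE : t = `|p|^-1.
    by move: w1; rewrite wt normrZ ger0_norm// => /(canRL (mulfK np')); rewrite mul1r.
  by move: we; rewrite wt tE subrr normr0 leNgt e0.
have [opC _ CZ] := oC.
have [e1 e10 he1] := open_ballP opC (DC Dx).
have psix := psiC (DC Dx).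
pose r := 3%:R / (c * e1) * (m.+3%:R * `|phi|).
have r0 : 0 <= r by rewrite !mulr_ge0// invr_ge0 mulr_ge0// ltW.
(* Once the norm of A x exceeds [N], its inverse is below [e], and psi(A x) = psi(x) divided by that
   norm is below [k]. *)
pose N := e^-1 + linform psi x / k.
have N0 : 0 < N by rewrite addr_gt0 ?invr_gt0 ?divr_gt0.
have [A SA hA] := unbounded (r * N).
have AxN : N < `|A *m x|.
  rewrite ltNge; apply/negP => AxN; move: hA; apply/negP; rewrite -leNgt.
  have := cone_mx_norm_le c0 Cphi e10 he1 (fun v => SC SA (v := v)).
  move=> /le_trans; apply; rewrite /r -[leRHS]mulrA ler_wpM2l//.
    by rewrite divr_ge0// mulr_ge0// ltW.
  rewrite (le_trans (ler_norm _))// (le_trans (linform_le _ _))//.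
  by rewrite ler_wpM2l// mulr_ge0.
have Ax0 := lt_trans N0 AxN.
have sAx : `| `|A *m x|^-1 *: (A *m x)| = 1.
  by rewrite normrZ gtr0_norm ?invr_gt0// mulVf// gt_eqF.
exists A, `|A *m x|^-1; split => //; rewrite ?invr_gt0//.
  rewrite -[ltRHS]invrK ltf_pV2 ?posrE ?invr_gt0// (lt_trans _ AxN)//.
  by rewrite ltrDl divr_gt0.
rewrite ltNge; apply/negP => far.
have : k <= linform psi (`|A *m x|^-1 *: (A *m x)).
  by apply: Fk; split => //; apply/subset_closure/CZ; rewrite ?invr_gt0//; exact/SC/DC.
rewrite linformZ linform_mul Spsi// mulrC ler_pdivlMr// leNgt => /negP; apply.
rewrite mulrC -ltr_pdivrMr// (lt_trans _ AxN)// /N addrC ltrDl invr_gt0//.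
Qed.

Lemma parabolic_point_closure : closure D p.
Proof.
have [x Dx] := D0; have np : 0 < `|p| by rewrite normr_gt0.
have np' : `|p| != 0 by rewrite gt_eqF.
have [_ _ DZ] := oD.
apply/closureP_ball => e e0.
have [|A [s [SA s0 _ _ hs]]] := parabolic_orbit_limit Dx (e := e / `|p|).
  by rewrite divr_gt0.
exists (`|p| *: (s *: (A *m x))); first by do 2!apply: (DZ) => //; exact: SD.
rewrite -{1}[p]scale1r -(mulfV np') -scalerA -scalerBr.
by rewrite normrZ normr_id mulrC -ltr_pdivlMr.
Qed.

(** The rescaled orbit points s A x converge to p/|p| with s tending to 0, while the invariant form
    takes the value s^2 Q(x, x) on them. *)
Lemma parabolic_point_null (Q : 'M[R]_m.+3) :
  (forall A, S A -> A^T *m Q *m A = Q) -> p^T *m Q *m p = 0.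
Proof.
move=> SQ; have [x Dx] := D0; have np : 0 < `|p| by rewrite normr_gt0.
pose q : V := `|p|^-1 *: p.
pose B (u v : V) := (u^T *m Q *m v) 0 0.
have Ble u v : `|B u v| <= m.+3%:R * (m.+3%:R * `|u| * `|Q|) * `|v|.
  rewrite (le_trans (mx_entry_le _ _ _))// (le_trans (mx_norm_mul _ _))//.
  by rewrite ler_wpM2r// ler_wpM2l// (le_trans (mx_norm_mul _ _))// mx_norm_tr.
have BBl u u' v : B (u - u') v = B u v - B u' v.
  by rewrite /B linearB /= !mulmxBl mxE; congr (_ + _); rewrite mxE.
have BBr u v v' : B u (v - v') = B u v - B u v'.
  by rewrite /B !mulmxBr mxE; congr (_ + _); rewrite mxE.
have q1 : `|q| = 1 by rewrite normrZ gtr0_norm ?invr_gt0// mulVf// gt_eqF.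
pose K := `|B x x| + 2%:R * (m.+3%:R * (m.+3%:R * `|Q|)).
have small e : 0 < e -> e < 1 -> `|B q q| <= e * K.
  move=> e0 e1; have [A [s [SA s0 se w1 qw]]] := parabolic_orbit_limit Dx e0.
  set w := s *: (A *m x) in w1 qw.
  have Bw : B w w = s ^+ 2 * B x x.
    rewrite /B /w [(s *: _)^T]linearZ /= -!scalemxAl -scalemxAr scalerA mxE -expr2.
    by rewrite trmx_mul -[in RHS](SQ _ SA) !mulmxA.
  have -> : B q q = B w w + (B (q - w) q + B w (q - w)).
    by rewrite BBl BBr; ring.
  rewrite (le_trans (ler_normD _ _))// mulrDr lerD//.
    rewrite Bw normrM ler_wpM2r// normrX gtr0_norm// expr2.
    by rewrite (le_trans _ (ltW se))// ler_piMl ?(ltW s0)// (le_trans (ltW se))// ltW.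
  have qwe : `|q - w| <= e := ltW qw.
  have k0 : 0 <= m.+3%:R * (m.+3%:R * `|Q|) by rewrite !mulr_ge0.
  set k := m.+3%:R * (m.+3%:R * `|Q|) in k0 *.
  rewrite (le_trans (ler_normD _ _))//.
  have -> : e * (2%:R * k) = k * e + k * e by ring.
  apply: lerD.
    rewrite (le_trans (Ble _ _))// q1 mulr1.
    have -> : m.+3%:R * (m.+3%:R * `|q - w| * `|Q|) =
      k * `|q - w| by rewrite /k; ring.
    by rewrite ler_wpM2l.
  rewrite (le_trans (Ble _ _))// w1.
  have -> : m.+3%:R * (m.+3%:R * 1 * `|Q|) = k by rewrite mulr1.
  by rewrite ler_wpM2l.
have K0 : 0 <= K by rewrite addr_ge0// !mulr_ge0.
have Bq : B q q = 0.
  apply/eqP; rewrite -normr_le0 leNgt; apply/negP => B0.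
  pose e := Num.min 2^-1 (`|B q q| / (2 * (K + 1))).
  have e0 : 0 < e by rewrite lt_min invr_gt0 ltr0n divr_gt0// mulr_gt0// ltr_wpDl.
  have e1 : e < 1 by rewrite gt_min invf_lt1// ltr1n.
  have := small e e0 e1; apply/negP; rewrite -ltNge.
  have : e <= `|B q q| / (2 * (K + 1)) by rewrite ge_min lexx orbT.
  rewrite ler_pdivlMr ?mulr_gt0 ?ltr_wpDl//.
  by have := mulr_ge0 (ltW e0) K0; nra.
have : p^T *m Q *m p = (`|p| ^+ 2 * B q q)%:M.
  rewrite [LHS]mx11_scalar; congr _%:M.
  rewrite /B /q [(_ *: p)^T]linearZ /= -!scalemxAl -scalemxAr scalerA
    [(_ *: (p^T *m Q *m p)) 0 0]mxE mulrA.
  by rewrite -expr2 -exprMn mulfV ?expr1n ?mul1r// gt_eqF.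
by rewrite Bq mulr0 raddf0.
Qed.

(** Pull back by [g] a null frame at g p. The lattice lemmas give both bounds on Z = 1; they pass to
    psi = 1 because psi is a nonzero multiple k of Z. *)
Lemma parabolic_cobounded :
  (exists M : R, forall v, linform psi v = 1 ->
     exists A s, S A /\ `|A *m v + s *: p| <= M) /\
  (forall x, linform psi x = 1 -> exists M : R, forall v, linform psi v = 1 ->
     exists A s, S A /\ `|v - A *m x + s *: p| <= M).
Proof.
have [g gu SQ] := PO_invariant_form Sdet SPO.
set Q := g^T *m lorentz *m g in SQ.
have Qu : Q \in unitmx.
  by rewrite /Q !unitmx_mul unitmx_tr gu unitmxE unitfE det_lorentz_neq0.
have gp0 : g *m p != 0 by apply: contra_neq p0 => gp; rewrite -[p](mulKmx gu) gp mulmx0.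
have [|X' [Z' [Y' [JE X'p Z'p Y'p]]]] := lorentz_null_frame gp0.
  by have := parabolic_point_null SQ; rewrite trmx_mul /Q !mulmxA.
pose X := X' *m g; pose Z := Z' *m g; pose Y := Y' *m g.
have QE : Q = Y^T *m Y - X^T *m Z - Z^T *m X.
  by rewrite /Q JE !mulmxBr !mulmxBl /X /Y /Z !trmx_mul !mulmxA.
have Xp : X *m p = 1%:M by rewrite -mulmxA.
have Zp : Z *m p = 0 by rewrite -mulmxA.
have Yp : Y *m p = 0 by rewrite -mulmxA.
have [x [P [[frame1 Xx Zx Yx] [XP ZP YP]]]] := frame_inverse QE Qu Xp Zp Yp.
have [h [hS hinj hD _]] := SZ.
have [M HM] := lattice_cobounded1 QE Xp Zp Yp frame1 Xx Zx Yx XP ZP YP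
  Sgrp Sdisc SQ Sp hS hinj hD.
have cob2 := lattice_cobounded2 QE Xp Zp Yp frame1 Xx Zx Yx XP ZP YP
  Sgrp Sdisc SQ Sp hS hinj hD.
have Zx1 : linform Z x = 1 by rewrite /linform Zx mxE.
(* psi is bounded on [Z = 1], hence proportional to Z *)
have psi_bounded v : linform Z v = 1 -> linform psi v <= m.+3%:R * `|psi| * M.
  move=> /HM[A [s [SA hA]]].
  have -> : linform psi v = linform psi (A *m v + s *: p).
    by rewrite linformD linformZ psip mulr0 addr0 linform_mul Spsi.
  by rewrite (le_trans (ler_norm _))// (le_trans (linform_le _ _))// ler_wpM2l ?mulr_ge0.
have psi_kerZ u : linform Z u = 0 -> linform psi u = 0.
  move=> Zu; apply/eqP; apply: contraT => psiu.
  pose K := m.+3%:R * `|psi| * M.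
  have := psi_bounded (x + ((K + 1 - linform psi x) / linform psi u) *: u).
  rewrite !linformD !linformZ Zu mulr0 addr0 mulfVK// addrC subrK -/K.
  by move=> /(_ Zx1); rewrite gerDl ler10.
pose k := linform psi x.
have psiE v : linform psi v = k * linform Z v.
  have : linform psi (v - linform Z v *: x) = 0.
    by apply: psi_kerZ; rewrite linformB linformZ Zx1 mulr1 subrr.
  by rewrite linformB linformZ => /eqP; rewrite subr_eq0 mulrC => /eqP.
have k0 : k != 0.
  have [y /DC/psiC] := D0; rewrite psiE => h0.
  by apply: contraTneq h0 => ->; rewrite mul0r ltxx.
have Zk v : linform psi v = 1 -> linform Z (k *: v) = 1 by rewrite psiE linformZ.
have kp : 0 < `|k| by rewrite normr_gt0.
split.
  exists (M / `|k|) => v /Zk/HM[A [s [SA hA]]]; exists A, (s / k); split => //.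
  rewrite ler_pdivlMr// mulrC -normrZ scalerDr scalerA mulrC divfK//.
  by rewrite scalemxAr.
move=> y /Zk/cob2[L HL]; exists (L / `|k|) => v /Zk/HL[A [s [SA hA]]].
exists A, (s / k); split => //.
rewrite ler_pdivlMr// mulrC -normrZ scalerDr scalerA mulrC divfK//.
by rewrite scalerBr scalemxAr.
Qed.

End ParabolicCobounded.

(** * Projective space *)

Section ProjectiveTopology.
Local Open Scope quotient_scope.
Context {R : realType} {n : nat}.
Local Notation V := 'cV[R]_n.+1.
Implicit Types (X U : set (RP R n)) (v w : V) (A : 'M[R]_n.+1).

(** The saturated preimage through which the quotient topology is handled. Unlike [cone], it
    contains both signs of each vector. *)
Definition lift X : set V := [set v | v != 0 /\ X (projectivize v)].

Let rep v : {x | x \in @nonzero R n} :=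
  insubd (exist (fun v => v \in nonzero) _ const1_nonzero) v.

Let val_rep v : v != 0 -> \val (rep v) = v.
Proof. by move=> v0; rewrite /rep val_insubd ifT//; exact: mem_set. Qed.

Let rep_val (x : @nonzero R n) : rep (\val x) = x.
Proof. by apply: val_inj; rewrite val_rep//; exact: (set_mem (valP x)). Qed.

Lemma projectivize_eq v w : v != 0 -> w != 0 ->
  projectivize v = projectivize w <-> exists2 c : R, c != 0 & v = c *: w.
Proof.
move=> v0 w0; split.
  by move/eqquotP => /asboolP[c c0]; rewrite !val_rep// => vw; exists c.
by move=> [c c0 vw]; apply/eqquotP/asboolP; exists c; rewrite ?val_rep.
Qed.

Lemma homog_neq0 (x : RP R n) : homog x != 0.
Proof. by rewrite /homog; case: (repr x) => y /= /set_mem. Qed.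

Lemma homogK : cancel (@homog R n) projectivize.
Proof. by move=> x; rewrite /projectivize /homog -/(rep _) rep_val reprK. Qed.

Lemma projectivizeZ (c : R) v : c != 0 -> v != 0 ->
  projectivize (c *: v) = projectivize v.
Proof.
by move=> c0 v0; apply/projectivize_eq; rewrite ?scaler_eq0 ?negb_or ?c0//; exists c.
Qed.

Lemma homog_projectivize v : v != 0 ->
  exists2 c : R, c != 0 & homog (projectivize v) = c *: v.
Proof.
by move=> v0; apply/projectivize_eq => //; [exact: homog_neq0|rewrite homogK].
Qed.

Lemma liftZ X (c : R) v : c != 0 -> lift X v -> lift X (c *: v).
Proof.
by move=> c0 [v0 Xv]; split; rewrite ?projectivizeZ// scaler_eq0 negb_or c0.
Qed.

Lemma open_nonzero : open [set v : V | v != 0].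
Proof.
apply: openP_ball => x /= x0; have nx : 0 < `|x| by rewrite normr_gt0.
exists (`|x| / 2) => [|u]; first by rewrite divr_gt0.
apply: contraTneq => /eqP; rewrite addrC addr_eq0 => /eqP ->.
by rewrite normrN -ltNge ltr_pdivrMr// ltr_pMr// ltr1n.
Qed.

Lemma open_lift X : open X <-> open (lift X).
Proof.
split=> [[U oU UX]|oX].
  have -> : lift X = U `&` [set v | v != 0].
    apply/seteqP; split => v.
      move=> [v0 Xv]; split => //; rewrite -[v]val_rep//.
      by have : (\val @^-1` U) (rep v) by rewrite UX.
    move=> [Uv v0]; split => //.
    have : (\pi_(RP R n) @^-1` X) (rep v).
      by rewrite -UX; change (U (\val (rep v))); rewrite val_rep.
    by [].
  exact: openI oU open_nonzero.
exists (lift X) => //; apply/seteqP; split => x /=.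
  by move=> [_]; rewrite /projectivize -/(rep _) rep_val.
move=> Xx; split; first by exact: (set_mem (valP x)).
by rewrite /projectivize -/(rep _) rep_val.
Qed.

(** Projectivization is an open map: the saturation of an open set is a union of its nonzero
    multiples. *)
Lemma lift_interior X : lift X° = (lift X)°.
Proof.
apply/seteqP; split => v.
  move=> [v0 Xv]; apply: (@interiorS _ (lift X°)).
    by move=> w [w0 Xw]; split => //; exact: interior_subset.
  by move/open_lift : (@open_interior _ X) => oX; rewrite (iffLR (interior_id _) oX).
move=> Xv; have [v0 _] := interior_subset Xv; split => //.
pose Y := projectivize @` (lift X)°.
have Y0 w : (lift X)° w -> w != 0 by move=> /interior_subset[].
have YX : Y `<=` X by move=> _ [w /interior_subset[_ Xw] <-].
suff oY : open Y by apply: (interiorS YX); rewrite (iffLR (interior_id _) oY); exists v.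
apply/open_lift/openP_ball => w [w0 [u Xu uw]].
have [c c0 wu] : exists2 c : R, c != 0 & w = c *: u.
  by apply/projectivize_eq => //; exact: Y0.
have [e e0 he] := open_ballP (@open_interior _ (lift X)) Xu.
exists (`|c| * e); first by rewrite mulr_gt0// normr_gt0.
move=> z ze; have zE : w + z = c *: (u + c^-1 *: z).
  by rewrite scalerDr scalerA mulfV// scale1r wu.
have Xuz : (lift X)° (u + c^-1 *: z).
  apply: he; rewrite normrZ normfV mulrC ler_pdivrMr ?normr_gt0//.
  by rewrite mulrC.
have uz0 := Y0 _ Xuz.
split; first by rewrite zE scaler_eq0 negb_or c0.
by exists (u + c^-1 *: z) => //; rewrite zE projectivizeZ.
Qed.

Lemma closure_lift X v : v != 0 -> closure X (projectivize v) <-> closure (lift X) v.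
Proof.
move=> v0; split.
  move=> clX; apply/closureP_ball => e e0.
  pose U : set V := ball v e `&` [set v | v != 0].
  have oU : open U by apply: openI; [exact: ball_open|exact: open_nonzero].
  have : nbhs (projectivize v) ((projectivize @` U)°).
    have : lift ((projectivize @` U)°) v.
      rewrite lift_interior; apply: (@interiorS _ U); last first.
        rewrite (iffLR (interior_id _) oU); split => //; exact: ballxx.
      by move=> w [wU w0]; split => //; exists w.
    by move=> [_ H]; apply: open_nbhs_nbhs; split => //; exact: open_interior.
  move=> /clX[x [Xx /interior_subset[w [wU w0] wx]]].
  exists w; first by split; rewrite ?wx.
  by move: wU; rewrite -ball_normE.
move=> clX U; rewrite nbhsE => -[W [oW Wv] WU].
have : nbhs v (lift W) by apply: open_nbhs_nbhs; split => //; exact/open_lift.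
by move=> /clX[w [[_ Xw] [_ Ww]]]; exists (projectivize w); split => //; exact: WU.
Qed.

Lemma mulmx_neq0 A v : A \in unitmx -> v != 0 -> A *m v != 0.
Proof. by move=> uA; apply: contra_neq => Av; rewrite -[v](mulKmx uA) Av mulmx0. Qed.

Lemma pact_projectivize A v : A \in unitmx -> v != 0 ->
  pact A (projectivize v) = projectivize (A *m v).
Proof.
move=> uA v0; have [c c0 hv] := homog_projectivize v0.
by rewrite /pact hv -scalemxAr projectivizeZ// mulmx_neq0.
Qed.

Lemma pact1 (x : RP R n) : pact 1%:M x = x.
Proof. by rewrite /pact mul1mx homogK. Qed.

Lemma pactM A B (x : RP R n) : A \in unitmx -> B \in unitmx ->
  pact (A *m B) x = pact A (pact B x).
Proof.
move=> uA uB; rewrite -[x]homogK pact_projectivize ?unitmx_mul ?uA// ?homog_neq0//.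
by rewrite !pact_projectivize ?mulmxA ?mulmx_neq0 ?homog_neq0.
Qed.

Lemma pactK A (x : RP R n) : A \in unitmx -> pact (invmx A) (pact A x) = x.
Proof. by move=> uA; rewrite -pactM ?unitmx_inv// mulVmx// pact1. Qed.

Lemma pactVK A (x : RP R n) : A \in unitmx -> pact A (pact (invmx A) x) = x.
Proof. by move=> uA; rewrite -pactM ?unitmx_inv// mulmxV// pact1. Qed.

Lemma continuous_pact A : A \in unitmx -> continuous (pact A).
Proof.
move=> uA; apply/continuousP => U /open_lift oU; apply/open_lift.
have -> : lift (pact A @^-1` U) = mulmx A @^-1` lift U.
  apply/seteqP; split => v /=.
    by move=> [v0]; rewrite /= pact_projectivize// => UAv; split => //; exact: mulmx_neq0.
  move=> [Av0 UAv]; have v0 : v != 0 by apply: contra_neq Av0 => ->; rewrite mulmx0.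
  by split => //=; rewrite pact_projectivize.
by apply: open_comp => // v _; exact: continuous_mulmx.
Qed.

Lemma pact_image_preimage A X : A \in unitmx ->
  pact A @` X = pact (invmx A) @^-1` X.
Proof.
move=> uA; apply/seteqP; split => [_ [x Xx <-]|x Xx] /=; first by rewrite pactK.
by exists (pact (invmx A) x); rewrite ?pactVK.
Qed.

Lemma pact_interior A X x : A \in unitmx -> pact A @` X `<=` X ->
  X° x -> X° (pact A x).
Proof.
move=> uA AX Xx; apply: (interiorS AX).
have : (pact A @` X°) `<=` (pact A @` X) by apply: image_subset; exact: interior_subset.
move/interiorS; apply; rewrite (iffLR (interior_id _) _); first by exists x.
rewrite pact_image_preimage//; apply: open_comp (@open_interior _ X) => y _.
by apply: continuous_pact; rewrite unitmx_inv.
Qed.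

End ProjectiveTopology.

(** * Cones over subsets of projective space *)

Section ProjectiveCones.
Context {R : realType} {n : nat}.
Local Notation V := 'cV[R]_n.+1.
Implicit Types (X K : set (RP R n)) (v w : V) (phi : 'rV[R]_n.+1).

Lemma linform0 phi : linform phi 0 = 0.
Proof. by rewrite /linform mulmx0 mxE. Qed.

Lemma linform_gt0_neq0 phi v : 0 < linform phi v -> v != 0.
Proof. by apply: contraTneq => ->; rewrite linform0 ltxx. Qed.

Lemma coneE phi X v : cone phi X v <-> 0 < linform phi v /\ X (projectivize v).
Proof.
split=> [[t [w [t0 [w1 Xw] ->]]]|[v0 Xv]].
  have w0 : w != 0 by apply: (@linform_gt0_neq0 phi); rewrite w1.
  by rewrite linformZ w1 mulr1 projectivizeZ// gt_eqF.
exists (linform phi v), ((linform phi v)^-1 *: v); split => //.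
  split; first by rewrite linformZ mulVf// gt_eqF.
  by rewrite projectivizeZ ?(linform_gt0_neq0 v0)// gt_eqF// invr_gt0.
by rewrite scalerA mulfV ?scale1r// gt_eqF.
Qed.

Lemma cone_lift phi X v : cone phi X v -> lift X v.
Proof. by move=> /coneE[v0 Xv]; split => //; exact: linform_gt0_neq0 v0. Qed.

Lemma hyperplane_projectivize phi v : v != 0 ->
  hyperplane phi (projectivize v) <-> linform phi v = 0.
Proof.
move=> v0; split=> [[w [w0 pw]]|pv]; last by exists v.
by move=> /esym/(projectivize_eq v0 w0)[c _ ->]; rewrite linformZ pw mulr0.
Qed.

Lemma off_hyperplane phi X v : X `&` hyperplane phi = set0 -> lift X v ->
  linform phi v != 0.
Proof.
move=> Xphi [v0 Xv]; apply/eqP => pv.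
have : (X `&` hyperplane phi) (projectivize v).
  by split => //; apply/hyperplane_projectivize.
by rewrite Xphi.
Qed.

Lemma open_linform_gt0 phi : open [set v | 0 < linform phi v].
Proof.
have -> : [set v | 0 < linform phi v] = linform phi @^-1` [set x | 0 < x] by [].
by apply: open_comp => [v _|]; [exact: continuous_linform|exact: open_gt].
Qed.

Lemma open_cone phi X : open X -> open (cone phi X).
Proof.
move=> /open_lift oX; have -> : cone phi X = [set v | 0 < linform phi v] `&` lift X.
  apply/seteqP; split => v.
    by move=> cv; split; [case/coneE: cv|exact: cone_lift cv].
  by move=> [pv [_ Xv]]; apply/coneE.
by apply: openI => //; exact: open_linform_gt0.
Qed.

Lemma coneZ phi X (t : R) v : 0 < t -> cone phi X v -> cone phi X (t *: v).
Proof.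
move=> t0 /coneE[pv Xv]; apply/coneE.
by rewrite linformZ mulr_gt0// projectivizeZ ?gt_eqF// (linform_gt0_neq0 pv).
Qed.

(** The cone over [K] is closed under sums; for interior points, a small error in u + v is absorbed
    by [u]. *)
Lemma convex_cone_interior phi K :
  compact_convex phi K -> open_convex_cone (cone phi K°).
Proof.
move=> [phi0 _ Kphi convK].
have KD u v : cone phi K u -> cone phi K v -> cone phi K (u + v).
  move=> /coneE[pu Ku] /coneE[pv Kv]; apply/coneE.
  have puv : 0 < linform phi (u + v) by rewrite linformD addr_gt0.
  split => //.
  set a := linform phi u in pu; set b := linform phi v in pv.
  have ab : 0 < a + b by rewrite addr_gt0.
  have ch w : 0 < linform phi w -> K (projectivize w) ->
      chart phi K ((linform phi w)^-1 *: w).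
    move=> pw Kw; split; first by rewrite linformZ mulVf// gt_eqF.
    by rewrite projectivizeZ ?(linform_gt0_neq0 pw)// gt_eqF// invr_gt0.
  (* With weights a/(a+b) and b/(a+b), the normalized sum is a convex combination of u/a and v/b. *)
  have t01 : 0 <= a / (a + b) <= 1.
    by rewrite divr_ge0 ?(ltW pu) ?(ltW ab)//= ler_pdivrMr// mul1r lerDl ltW.
  set t := a / (a + b) in t01.
  have : chart phi K (t *: (a^-1 *: u) + (1 - t) *: (b^-1 *: v)).
    exact: set_mem (convK (a^-1 *: u) (b^-1 *: v) (Itv01 (andP t01).1 (andP t01).2)
      (mem_set (ch _ pu Ku)) (mem_set (ch _ pv Kv))).
  have [a0 b0 ab0] := And3 (lt0r_neq0 pu) (lt0r_neq0 pv) (lt0r_neq0 ab).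
  have -> : t *: (a^-1 *: u) + (1 - t) *: (b^-1 *: v) = (a + b)^-1 *: (u + v).
    apply/colP => i; rewrite !mxE /t; field.
    by rewrite a0 b0 ab0.
  by move=> [_]; rewrite projectivizeZ ?invr_eq0// (linform_gt0_neq0 puv).
split; first exact/open_cone/open_interior.
  move=> u v Du Dv; have KV w : cone phi K° w -> cone phi K w.
    by move=> /coneE[? /interior_subset ?]; apply/coneE.
  apply/coneE; split.
    by rewrite linformD addr_gt0//; [case/coneE: Du|case/coneE: Dv].
  suff : lift K° (u + v) by case.
  rewrite lift_interior.
  have [e e0 he] := open_ballP (@open_cone phi _ (@open_interior _ K)) Du.
  apply/nbhs_ballP; exists e => //= w; rewrite -ball_normE /= => uvw.
  apply: (@cone_lift phi).
  have -> : w = (u + (w - (u + v))) + v.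
    by apply/colP => i; rewrite !mxE; ring.
  by apply: KD; [apply/KV/he; rewrite distrC ltW|exact: KV].
by move=> t u; exact: coneZ.
Qed.

(** Two values of opposite signs would give a positive combination at which [phi] vanishes. *)
Lemma linform_const_sign phi (D : set V) : open_convex_cone D ->
  (forall v, D v -> linform phi v != 0) ->
  (forall v, D v -> 0 < linform phi v) \/ (forall v, D v -> linform phi v < 0).
Proof.
move=> [_ DD DZ] Dphi.
have [pos|/existsNP[u /not_implyP[Du /negP]]] := pselect (forall v, D v -> 0 < linform phi v).
  by left.
rewrite -leNgt le_eqVlt (negbTE (Dphi u Du)) /= => u0; right => v Dv.
rewrite lt_neqAle Dphi//= leNgt; apply/negP => v0.
have := Dphi (linform phi v *: u + (- linform phi u) *: v).
rewrite linformD !linformZ mulrC mulNr subrr eqxx => H; suff: false by [].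
by apply: H; apply: DD; apply: DZ; rewrite ?oppr_gt0.
Qed.

(** Changing the hyperplane at infinity changes the cone at most by a global sign. *)
Lemma open_convex_cone_chart phi phi' X :
  open_convex_cone (cone phi' X) -> X `&` hyperplane phi' = set0 ->
  X `&` hyperplane phi = set0 -> open_convex_cone (cone phi X).
Proof.
move=> oX X' Xphi; have [oD DD DZ] := oX.
have Dphi v : cone phi' X v -> linform phi v != 0.
  by move=> /cone_lift; exact: off_hyperplane.
have [pos|neg] := linform_const_sign oX Dphi.
  suff -> : cone phi X = cone phi' X by [].
  apply/seteqP; split => v; last first.
    by move=> Dv; apply/coneE; split; [exact: pos|case/coneE: Dv].
  move=> Dv; have Lv := cone_lift Dv; have [v0 Xv] := Lv.
  apply/coneE; split => //; rewrite lt_neqAle eq_sym (off_hyperplane X' Lv) /= leNgt.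
  apply/negP => neg; have /pos : cone phi' X (- v).
    apply/coneE; rewrite linformN oppr_gt0; split => //.
    by rewrite -scaleN1r projectivizeZ// oppr_eq0 oner_eq0.
  by rewrite linformN oppr_gt0 ltNge ltW//; case/coneE: Dv.
have E v : cone phi X v <-> cone phi' X (- v).
  split => [Dv|Dv].
    have Lv := cone_lift Dv; have [v0 Xv] := Lv.
    have XN : X (projectivize (- v)).
      by rewrite -scaleN1r projectivizeZ// oppr_eq0 oner_eq0.
    apply/coneE; split => //; rewrite linformN oppr_gt0.
    rewrite lt_neqAle (off_hyperplane X' Lv) /= leNgt; apply/negP => pos.
    have /neg : cone phi' X v by apply/coneE.
    by rewrite ltNge ltW//; case/coneE: Dv.
  have [v0 Xv] := cone_lift Dv; rewrite oppr_eq0 in v0.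
  apply/coneE; split; first by rewrite -oppr_lt0 -linformN; exact: neg.
  by rewrite -[v]opprK -scaleN1r projectivizeZ ?oppr_eq0 ?oner_eq0.
split => [|u v /E Du /E Dv|t u t0 /E Du].
- have -> : cone phi X = -%R @^-1` cone phi' X by apply/seteqP; split => v /E.
  by apply: open_comp oD => v _; exact: opp_continuous.
- by apply/E; rewrite opprD; exact: DD.
- by apply/E; rewrite -scalerN; exact: DZ.
Qed.

(** The functional hidden in [strictly_convex] may differ from [phi], so its cone is carried over by
    [open_convex_cone_chart]. *)
Lemma strictly_convex_cone phi X : strictly_convex X ->
  X `&` hyperplane phi = set0 ->
  [/\ open X, open_convex_cone (cone phi X) & cone phi X !=set0].
Proof.
move=> [[x Xx] [phi' [K [cK XE _]]]] Xphi.
have [_ _ Kphi' _] := cK.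
have oX : open X by rewrite XE; exact: open_interior.
split => //.
  apply: (@open_convex_cone_chart phi phi') => //.
    by rewrite XE; exact: convex_cone_interior.
  apply/seteqP; split => // y [Xy Hy]; rewrite -Kphi'; split => //.
  by move: Xy; rewrite XE => /interior_subset.
have Lx : lift X (homog x) by split; [exact: homog_neq0|rewrite homogK].
have := off_hyperplane Xphi Lx; rewrite neq_lt => /orP[neg|pos].
  exists (- homog x); apply/coneE; rewrite linformN oppr_gt0; split => //.
  by rewrite -scaleN1r projectivizeZ ?oppr_eq0 ?oner_eq0 ?homog_neq0// homogK.
by exists (homog x); apply/coneE; rewrite homogK.
Qed.

Lemma closure_cone_lift phi X v : closure (cone phi X) v -> v != 0 ->
  closure X (projectivize v).
Proof.
by move=> clv v0; apply/closure_lift => //; apply: closureS clv => w /cone_lift.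
Qed.

Lemma closure_coneP phi X v : 0 < linform phi v -> closure X (projectivize v) ->
  closure (cone phi X) v.
Proof.
move=> pv /closure_lift clv; have {}clv := clv (linform_gt0_neq0 pv).
move=> U Uv; have /clv[w [[w0 Xw] [pw Uw]]] : nbhs v ([set w | 0 < linform phi w] `&` U).
  by apply: filterI => //; apply: open_nbhs_nbhs; split => //; exact: open_linform_gt0.
by exists w; split => //; apply/coneE.
Qed.

(** The unit vectors in the closure of the cone form a compact set on which [phi] does not
    vanish. *)
Lemma cone_linform_bound phi X : closure X `&` hyperplane phi = set0 ->
  exists2 c : R, 0 < c & forall v, cone phi X v -> c * `|v| <= linform phi v.
Proof.
move=> Xphi; pose F := closure (cone phi X) `&` [set v | `|v| = 1].
have cF : closed F.
  apply: closedI; first exact: closed_closure.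
  apply: (@preimage_closed _ _ (fun z : V => `|z|) [set 1]); last exact: closed_eq.
  by move=> ? _; exact: norm_continuous.
have [|v [clv v1]|c c0 Fc] := @compact_linform_gt0 _ _ phi F 1 cF.
- by move=> v [_ ->].
- have v0 : v != 0 by rewrite -normr_eq0 v1 oner_eq0.
  have H w : cone phi X w -> 0 * `|w| <= linform phi w.
    by rewrite mul0r => /coneE[/ltW].
  have := linform_closure_ge H clv; rewrite mul0r le_eqVlt => /predU1P[p0|//].
  have : (closure X `&` hyperplane phi) (projectivize v).
    by split; [exact: closure_cone_lift clv v0|apply/hyperplane_projectivize].
  by rewrite Xphi.
exists c => // v Dv; have v0 : v != 0 by case: (cone_lift Dv).
have nv : 0 < `|v| by rewrite normr_gt0.
have : c <= linform phi (`|v|^-1 *: v).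
  apply: Fc; split; first by apply/subset_closure/coneZ; rewrite ?invr_gt0.
  by rewrite /= normrZ gtr0_norm ?invr_gt0// mulVf// gt_eqF.
by rewrite linformZ mulrC ler_pdivlMr.
Qed.

End ProjectiveCones.

(** * Components of the preimage of the cusp *)

Section Components.
Local Open Scope quotient_scope.
Context {R : realType} {n : nat}.
Variables (Omega : set (RP R n)) (Gamma : set 'M[R]_n.+1).
Hypothesis Ggrp : is_subgroup Gamma.
Hypothesis GOmega : forall A, Gamma A -> pact A @` Omega = Omega.

Lemma proj_orbit_pact A (x : RP R n) : Gamma A ->
  proj_orbit Gamma (pact A x) = proj_orbit Gamma x.
Proof.
move=> GA; have [Gu _ GM GV] := Ggrp; have uA := Gu _ GA.
apply/seteqP; split => _ [E GE <-].
  by exists (E *m A); [exact: GM|rewrite pactM//; exact: Gu].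
exists (E *m invmx A); first by apply: GM => //; exact: GV.
by rewrite pactM ?unitmx_inv// ?pactK//; exact: Gu.
Qed.

Lemma cover_preimage_pact (B : set (orbit_space Omega Gamma)) A z : Gamma A ->
  cover_preimage B z -> cover_preimage B (pact A z).
Proof.
move=> GA [x Bx <-].
have OAx : Omega (pact A (\val x)).
  have : (pact A @` Omega) (pact A (\val x)).
    by exists (\val x) => //; exact: set_mem (valP x).
  by rewrite GOmega.
pose y : Omega := exist (fun z => z \in Omega) _ (mem_set OAx).
exists y => //=.
suff -> : \pi_(orbit_space Omega Gamma) y = \pi_(orbit_space Omega Gamma) x by [].
by apply/eqquotP/asboolP => /=; exact: proj_orbit_pact.
Qed.

(** The image of [Bt] is a connected part of the preimage that meets [Bt], so it lies in [Bt] by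
    maximality; the same holds for the inverse. *)
Lemma component_precisely_invariant (B : set (orbit_space Omega Gamma)) Bt A y :
  is_component (cover_preimage B) Bt -> Gamma A -> Bt y -> Bt (pact A y) ->
  pact A @` Bt = Bt.
Proof.
move=> [x0 Px0 BtE]; have [Gu _ _ GV] := Ggrp.
have sub E z : Gamma E -> Bt z -> Bt (pact E z) -> pact E @` Bt `<=` Bt.
  move=> GE Bz BEz; have BtE' : Bt = connected_component (cover_preimage B) (pact E z).
    by rewrite BtE; apply: same_connected_component; rewrite -BtE.
  rewrite {2}BtE'; apply: connected_component_max.
  - by exists z.
  - by move=> _ [w Bw <-]; apply: cover_preimage_pact => //;
      apply: (@connected_component_sub _ _ x0); rewrite -BtE.
  - apply: connected_continuous_connected.
      by rewrite BtE; exact: component_connected.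
    by apply: continuous_subspaceT; apply: continuous_pact; exact: Gu.
move=> GA By BAy; have uA := Gu _ GA; apply/seteqP; split; first exact: sub By BAy.
move=> z Bz; exists (pact (invmx A) z); last by rewrite pactVK.
apply: (sub (invmx A) (pact A y)); rewrite ?pactK//; first exact: GV.
Qed.

Lemma stabilizer_subgroup Bt : is_subgroup (stabilizer Gamma Bt).
Proof.
have [Gu G1 GM GV] := Ggrp; split.
- by move=> A [/Gu].
- split => //; apply/seteqP; split => [_ [x Bx <-]|x Bx]; first by rewrite pact1.
  by exists x => //; rewrite pact1.
- move=> A E [GA AB] [GE EB]; split; first exact: GM.
  rewrite -[RHS]AB -[in RHS]EB image_comp; apply: eq_imagel => x _ /=.
  by rewrite pactM//; exact: Gu.
- move=> A [GA AB]; split; first exact: GV.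
  rewrite -[in LHS]AB image_comp; apply/seteqP; split => [_ [x Bx <-]|x Bx] /=.
    by rewrite pactK//; exact: Gu.
  by exists x => //=; rewrite pactK//; exact: Gu.
Qed.

End Components.

Lemma discrete_subset_sub (T : topologicalType) (A B : set T) :
  A `<=` B -> discrete_subset B -> discrete_subset A.
Proof.
move=> AB dB x Ax; have [_ [U Ux UB]] := dB _ (AB _ Ax); split; first exact: mem_set.
exists U => //; apply/seteqP; split => [y [Uy Ay]|_ ->].
  by rewrite -UB; split => //; exact: AB.
by split => //; exact: nbhs_singleton.
Qed.

(** * The case n = 1 *)

Section Plane.
Context {R : realType}.
Local Notation V := 'cV[R]_2.

(** [psi] and [alpha] are the basis dual to [x], [p]. *)
Lemma plane_coordinates (psi : 'rV[R]_2) (p x : V) :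
  p != 0 -> linform psi p = 0 -> linform psi x = 1 ->
  exists alpha : 'rV[R]_2, [/\ linform alpha p = 1, linform alpha x = 0 &
    forall v, v = linform psi v *: x + linform alpha v *: p].
Proof.
move=> p0 psip psix.
have [chi chip] : exists chi : 'rV[R]_2, linform chi p = 1.
  have pT0 : p^T != 0 by apply: contra_neq p0 => /(congr1 trmx); rewrite trmxK trmx0.
  have [v hv] := linform_neq0 pT0.
  exists v^T; rewrite -hv /linform -[v^T *m p]trmxK trmx_mul trmxK mxE.
  by [].
pose alpha := chi - linform chi x *: psi.
have alphaE v : linform alpha v = linform chi v - linform chi x * linform psi v.
  by rewrite linformDl linformNl linformZl.
have ap : linform alpha p = 1 by rewrite alphaE psip mulr0 subr0.
have ax : linform alpha x = 0 by rewrite alphaE psix mulr1 subrr.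
exists alpha; split => // v.
have one (phi : 'rV[R]_2) (w : V) : phi *m w = (linform phi w)%:M.
  by rewrite [LHS]mx11_scalar.
have inv1 : (col_mx psi alpha : 'M[R]_(1 + 1)) *m (row_mx x p : 'M[R]_(1 + 1)) = 1%:M.
  rewrite mul_col_row !one psix psip ap ax raddf0.
  by rewrite -scalar_mx_block.
have := mulmx1C inv1; rewrite mul_row_col => /(congr1 (mulmx^~ v)).
by rewrite mul1mx mulmxDl -!mulmxA !one !mul_mx_scalar => /esym.
Qed.

(* For n = 1, [Omega] is an open interval and [Bt] a subinterval that accumulates
   at the end [p]. *)
Lemma plane_cusp_closure (phi psi : 'rV[R]_2) (Omega Bt : set (RP R 1)) (p : V) :
  Omega `&` hyperplane phi = set0 ->
  open_convex_cone (cone phi Omega) -> open_convex_cone (cone phi Bt°) ->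
  cone phi Bt° !=set0 -> p != 0 -> 0 < linform phi p -> linform psi p = 0 ->
  (forall v, cone phi Omega v -> 0 < linform psi v) -> closure (cone phi Omega) p ->
  Bt `<=` Omega -> connected Bt -> closure Bt (projectivize p) ->
  closure (cone phi Bt°) p.
Proof.
move=> Ophi oC oD D0 p0 phip psip psiC clp BO cB clB.
have DB v : cone phi Bt° v -> cone phi Bt v.
  by move=> /coneE[? /interior_subset ?]; apply/coneE.
have BC v : cone phi Bt v -> cone phi Omega v.
  by move=> /coneE[? /BO ?]; apply/coneE.
have psiD v : cone phi Bt° v -> 0 < linform psi v by move=> /DB/BC/psiC.
have [x Dx x1] := cusp_cone_normalized oD psiD D0.
have Cx := BC _ (DB _ Dx).
have [alpha [ap ax dec]] := plane_coordinates p0 psip x1.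
have phix : 0 < linform phi x by case/coneE: Dx.
have Bray s : 0 < s -> cone phi Bt (x + s *: p).
  move=> s0; have Cw := cone_add_ge0 oC Cx clp (ltW s0).
  set w := x + s *: p in Cw *.
  apply/coneE; split; first by case/coneE: Cw.
  apply: contrapT => Bw.
  pose theta v := linform alpha v - s * linform psi v.
  have thetaE : theta =1 linform (alpha - s *: psi).
    by move=> v; rewrite /theta linformDl linformNl linformZl.
  (* [theta] vanishes on the line of [w]. The product has degree 2, so its sign does not depend on
     the representative; [U] is the side of [x], and U' the side of [p]. *)
  pose U : set (RP R 1) := [set y | theta (homog y) * linform psi (homog y) < 0].
  pose U' : set (RP R 1) := [set y | 0 < theta (homog y) * linform psi (homog y)].
  have homE v : v != 0 -> exists2 k : R, 0 < k &
      theta (homog (projectivize v)) * linform psi (homog (projectivize v)) =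
      k * (theta v * linform psi v).
    move=> v0; have [k k0 ->] := homog_projectivize v0.
    exists (k ^+ 2); first by rewrite exprn_even_gt0.
    by rewrite !thetaE !linformZ; ring.
  have ctheta : continuous (fun v : V => theta v * linform psi v).
    move=> v; apply: (@continuousM _ _ theta (linform psi)); last exact: continuous_linform.
    by rewrite (funext thetaE); exact: continuous_linform.
  have oU : open U.
    apply/open_lift.
    have -> : lift U = [set v : V | v != 0] `&`
        ((fun v => theta v * linform psi v) @^-1` [set t | t < 0]).
      apply/seteqP; split => v [v0]; have [k k0 kE] := homE v v0.
        by rewrite /U /= kE pmulr_rlt0.
      by move=> /= h; split => //; rewrite /U /= kE pmulr_rlt0.
    apply: openI; first exact: open_nonzero.
    by apply: open_comp => [v _|]; [exact: ctheta|exact: open_lt].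
  have oU' : open U'.
    apply/open_lift.
    have -> : lift U' = [set v : V | v != 0] `&`
        ((fun v => theta v * linform psi v) @^-1` [set t | 0 < t]).
      apply/seteqP; split => v [v0]; have [k k0 kE] := homE v v0.
        by rewrite /U' /= kE pmulr_rgt0.
      by move=> /= h; split => //; rewrite /U' /= kE pmulr_rgt0.
    apply: openI; first exact: open_nonzero.
    by apply: open_comp => [v _|]; [exact: ctheta|exact: open_gt].
  (* On [Bt] the product has no zero: [psi] does not vanish on [Omega], and a zero of [theta] would
     put [w] over [Bt]. *)
  have BU : Bt `&` U = Bt `&` ~` U'.
    apply/seteqP; split => y [By].
      by rewrite /U /U' /= => h; split => // h'; move: (lt_trans h h'); rewrite ltxx.
    rewrite /U /U' /= => /negP; rewrite -leNgt => h; split => //=.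
    rewrite lt_neqAle h andbT mulf_eq0 negb_or; apply/andP; split.
      apply/eqP => th0; apply: Bw; have hE := dec (homog y).
      have aE : linform alpha (homog y) = s * linform psi (homog y).
        by apply/eqP; rewrite -subr_eq0 -/(theta _) th0.
      have hw : homog y = linform psi (homog y) *: w.
        by rewrite {1}hE aE /w scalerDr scalerA [s * _]mulrC.
      have w0 : w != 0 by case: (cone_lift Cw).
      have k0 : linform psi (homog y) != 0.
        by apply: contraTneq (homog_neq0 y) => k0; rewrite hw k0 scale0r eqxx.
      by rewrite -(projectivizeZ k0 w0) -hw homogK.
    have Ly : lift Omega (homog y).
      by split; [exact: homog_neq0|rewrite homogK; exact: BO].
    have := off_hyperplane Ophi Ly; rewrite neq_lt => /orP[neg|pos]; last first.
      by rewrite gt_eqF// psiC//; apply/coneE; split => //; case: Ly.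
    rewrite lt_eqF// -oppr_gt0 -linformN psiC//; apply/coneE.
    rewrite linformN oppr_gt0 -scaleN1r projectivizeZ ?oppr_eq0 ?oner_eq0 ?homog_neq0//.
    by split => //; case: Ly.
  have BE : Bt `&` U = Bt.
    apply: cB; [|by exists U|by exists (~` U') => //; exact: open_closedC].
    exists (projectivize x); split; first by case/coneE: (DB _ Dx).
    rewrite /U /=; have [k k0 ->] := homE x (linform_gt0_neq0 phix).
    by rewrite /theta ax x1 !mulr1 sub0r pmulr_rlt0// oppr_lt0.
  have clBp := closure_coneP phip clB.
  (* [Bt] accumulates at [p], where [theta] is positive, so it cannot stay on the side of [x]. *)
  have [|v [Bv tv]] := clBp [set v | 0 < linform (alpha - s *: psi) v].
    apply: open_nbhs_nbhs; split; first exact: open_linform_gt0.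
    by rewrite /= -thetaE /theta ap psip mulr0 subr0 ltr01.
  have : (Bt `&` U) (projectivize v) by rewrite BE; case/coneE: Bv.
  move=> [_]; rewrite /U /=; have [k k0 ->] := homE v (cone_lift Bv).1.
  by rewrite pmulr_rlt0// ltNge mulr_ge0// ltW// ?thetaE// psiC//; exact: BC.
(* The open sector between the rays of [x] and [p]; it is filled by the multiples of the points of
   [Bray], so it lies over the interior of [Bt]. *)
pose W := [set v | 0 < linform psi v] `&` [set v | 0 < linform alpha v].
have WB : W `<=` lift Bt°.
  have oW : open W by apply: openI; exact: open_linform_gt0.
  rewrite lift_interior -(iffLR (interior_id _) oW); apply: interiorS => v [pv av].
  rewrite [v]dec -[X in X *: p](mulVKf (lt0r_neq0 pv)) -scalerA -scalerDr.
  apply: liftZ; first exact: lt0r_neq0.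
  by apply: cone_lift; apply: Bray; rewrite mulr_gt0// invr_gt0.
apply: closure_coneP => //; apply/closure_lift => //; apply/closureP_ball => e e0.
have d0 : 0 < e / (2 * (`|x| + 1)) by rewrite divr_gt0// mulr_gt0// ltr_wpDl.
exists (p + (e / (2 * (`|x| + 1))) *: x).
  by apply: WB; split; rewrite /= linformD linformZ ?psip ?x1 ?ap ?ax
    ?mulr0 ?mulr1 ?add0r ?addr0.
rewrite opprD addNKr normrN normrZ gtr0_norm// mulrAC ltr_pdivrMr ?mulr_gt0 ?ltr_wpDl//.
by rewrite ltr_pM2l//; have := normr_ge0 x; lra.
Qed.

End Plane.

(** * Cusps *)

Section CuspDynamics.
Context {R : realType}.

(** Three cases. For n = 0 the cone is a ray and would contain [p]. For n = 1 the slice psi = 1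
    modulo [p] is a single point, and the identity of [S] suffices. For larger n the Lorentz form is
    used. *)
Lemma cusp_cobounded n (phi psi : 'rV[R]_n.+1) (c : R) (p : 'cV[R]_n.+1)
    (Omega Bt : set (RP R n)) (S : set 'M[R]_n.+1) :
  let C := cone phi Omega in let D := cone phi Bt° in
  Omega `&` hyperplane phi = set0 ->
  open_convex_cone C -> open_convex_cone D -> D !=set0 -> D `<=` C ->
  0 < c -> (forall v, C v -> c * `|v| <= linform phi v) ->
  is_subgroup S -> discrete_subset S -> (forall A, S A -> `|\det A| = 1) ->
  (forall A v, S A -> C v -> C (A *m v)) ->
  (forall A v, S A -> D v -> D (A *m v)) ->
  (forall A, S A -> A *m p = p) -> (forall A, S A -> psi *m A = psi) ->
  p != 0 -> 0 < linform phi p -> closure C p -> ~ C p ->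
  linform psi p = 0 -> (forall v, C v -> 0 < linform psi v) ->
  (forall v, closure C v -> linform psi v = 0 -> exists t, v = t *: p) ->
  conjugate_into_PO S -> virtually_Zk n.-1 S ->
  Bt `<=` Omega -> connected Bt -> closure Bt (projectivize p) ->
  [/\ closure D p,
      exists M : R, forall v, linform psi v = 1 ->
        exists A s, S A /\ `|A *m v + s *: p| <= M
    & forall x, linform psi x = 1 -> exists M : R, forall v, linform psi v = 1 ->
        exists A s, S A /\ `|v - A *m x + s *: p| <= M].
Proof.
case: n => [|[|m]] in phi psi p Omega Bt S * => C D Ophi oC oD D0 DC c0 Cphi
  Sgrp Sdisc Sdet SC SD Sp Spsi p0 phip clp Cp psip psiC psiker PO Zk BO cB clB.
- exfalso; apply: Cp; have [x /DC Cx] := D0.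
  have [_ _ CZ] := oC; have phix : 0 < linform phi x by case/coneE: Cx.
  have e (v : 'cV[R]_1) : linform phi v = phi 0 0 * v 0 0.
    by rewrite /linform mxE big_ord1.
  rewrite e in phip; rewrite e in phix.
  have x0 : x 0 0 != 0 by apply: contraTneq phix => ->; rewrite mulr0 ltxx.
  have -> : p = (p 0 0 / x 0 0) *: x.
    by apply/colP => i; rewrite !mxE !ord1 divfK.
  apply: CZ => //; rewrite -(pmulr_rgt0 _ phix).
  have -> : phi 0 0 * x 0 0 * (p 0 0 / x 0 0) = phi 0 0 * p 0 0 by field.
  exact: phip.
- have [_ S1 _ _] := Sgrp.
  split; first exact: (plane_cusp_closure Ophi oC oD D0 p0 phip psip psiC clp BO cB clB).
    have psiD v : D v -> 0 < linform psi v by move=> /DC/psiC.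
    have [x Dx x1] := cusp_cone_normalized oD psiD D0.
    have [alpha [_ _ dec]] := plane_coordinates p0 psip x1.
    exists `|x| => v v1; exists 1%:M, (- linform alpha v); split => //.
    by rewrite mul1mx {1}[v]dec v1 scale1r scaleNr addrK.
  move=> x x1; have [alpha [_ _ dec]] := plane_coordinates p0 psip x1.
  exists 0 => v v1; exists 1%:M, (- linform alpha v); split => //.
  by rewrite mul1mx {1}[v]dec v1 scale1r scaleNr addrAC addrK subrr normr0.
- have [cob1 cob2] := parabolic_cobounded oC DC c0 Cphi Sgrp Sdisc Sdet SC Sp Spsi
    D0 p0 phip psiC psip psiker PO Zk.
  split => //.
  exact: (parabolic_point_closure oC oD DC c0 Cphi Sgrp Sdisc SC Spsi
    SD D0 p0 phip psiC psiker Zk).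
Qed.

End CuspDynamics.

Section Eigen.
Context {R : realType} {n : nat}.
Implicit Types (A : 'M[R]_n.+1).

(** A nonnegative real number of modulus 1 is 1: thus parabolic elements fix vectors and functionals
    that they preserve up to a nonnegative factor. *)
Lemma parabolic_row_eigenvalue A (psi : 'rV[R]_n.+1) (a : R) :
  parabolic A -> psi != 0 -> psi *m A = a *: psi -> 0 <= a -> a = 1.
Proof.
move=> [ev _] psi0 psiA a0.
have : eigenvalue (map_mx (real_complex R) A) (real_complex R a).
  apply/eigenvalueP; exists (map_mx (real_complex R) psi).
    by rewrite -map_mxM psiA map_mxZ.
  by rewrite map_mx_eq0.
move=> /ev; rewrite normc_def /= expr0n /= addr0 sqrtr_sqr ger0_norm//.
by move=> /complexI.
Qed.

Lemma parabolic_col_eigenvalue A (p : 'cV[R]_n.+1) (a : R) :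
  parabolic A -> p != 0 -> A *m p = a *: p -> 0 <= a -> a = 1.
Proof.
move=> parA p0 Ap a0.
have : \det (A - a%:M) == 0.
  rewrite -det_tr; apply/det0P; exists p^T.
    by apply: contra_neq p0 => /(congr1 trmx); rewrite trmxK trmx0.
  by rewrite -trmx_mul mulmxBl Ap mul_scalar_mx subrr trmx0.
move=> /det0P[u u0]; rewrite mulmxBr mul_mx_scalar => /eqP.
rewrite subr_eq0 => /eqP uA; exact: parabolic_row_eigenvalue parA u0 uA a0.
Qed.

End Eigen.

(** * Discreteness of the orbit of the parabolic point *)

Theorem theorem0p1 (R : realType) (n : nat) (phi : 'rV[R]_n.+1)
    (Omega : set (RP R n)) (Gamma : set 'M[R]_n.+1)
    (B : set (orbit_space Omega Gamma)) (Bt : set (RP R n))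
    (p : 'cV[R]_n.+1) :
  strictly_convex_manifold phi Omega Gamma ->
  maximal_cusp B ->
  is_component (cover_preimage B) Bt ->
  lightcone phi Omega p ->
  parabolic_fixed_point Omega Bt (projectivize p) ->
  discrete_subset [set A *m p | A in Gamma].
Proof.
move=> [scO [phi0 clphi] [Ggrp GSL] Gdisc _] [_ _ _ Bcusp] comp lc pfp.
have [scB [q [H [pq fixq [[[psi0 psi00 HE] Hq] _] Spar [PO Zk]]]]] := Bcusp _ comp.
have {}pq : projectivize p = q.
  have : [set projectivize p] q by rewrite -pfp pq.
  by [].
subst q.
have Ophi : Omega `&` hyperplane phi = set0.
  apply/seteqP; split => // x [Ox Hx]; rewrite -clphi; split => //.
  exact: subset_closure.
have [oOm oC C0] := strictly_convex_cone scO Ophi.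
have [c c0 Cphi] := cone_linform_bound clphi.
set C := cone phi Omega in oC C0 Cphi.
have [Gu G1 GM GV] := Ggrp.
have GOmega A : Gamma A -> pact A @` Omega = Omega by move=> /GSL[].
have Gdet A : Gamma A -> `|\det A| = 1.
  by move=> /GSL[[->|->] _ _]; rewrite ?normrN normr1.
have GC A v : Gamma A -> C v -> C (A *m v).
  by move=> /GSL[_ _ imC] Cv; rewrite /C -imC; exists v.
have BO : Bt `<=` Omega.
  have [x0 _ ->] := comp; move=> y /connected_component_sub[z _ <-].
  exact: set_mem (valP z).
have BO' : Bt° `<=` Omega by move=> x /interior_subset/BO.
have Bphi : Bt° `&` hyperplane phi = set0.
  by apply/seteqP; split => // x [/BO' Ox Hx]; rewrite -Ophi.
have [oB oD D0] := strictly_convex_cone scB Bphi.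
set D := cone phi Bt° in oD D0.
have DC : D `<=` C by move=> v /coneE[pv /BO' Ov]; apply/coneE.
have connB : connected Bt by have [x0 _ ->] := comp; exact: component_connected.
pose S := stabilizer Gamma Bt.
have Sgrp : is_subgroup S by exact: stabilizer_subgroup.
have SG : S `<=` Gamma by move=> A [].
have Sdisc : discrete_subset S := discrete_subset_sub SG Gdisc.
have SD A v : S A -> D v -> D (A *m v).
  move=> [GA AB] Dv; have [pv Bv] := (coneE _ _ _).1 Dv.
  apply/coneE; split; first by case/coneE: (GC _ _ GA (DC _ Dv)).
  have v0 := linform_gt0_neq0 pv; rewrite -pact_projectivize//; last exact: Gu.
  by apply: pact_interior => //; [exact: Gu|rewrite AB].
have GD A x : Gamma A -> D x -> D (A *m x) -> S A.
  move=> GA /coneE[px /interior_subset Bx] /coneE[_ /interior_subset BAx].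
  split => //; apply: (component_precisely_invariant Ggrp GOmega comp GA Bx).
  by rewrite pact_projectivize ?(linform_gt0_neq0 px)//; exact: Gu.
have [phip [clOp nOp]] : 0 < linform phi p /\ frontier Omega (projectivize p).
  exact/coneE.
have p0 := linform_gt0_neq0 phip.
have clCp : closure C p by exact: closure_coneP.
have nCp : ~ C p by move=> /coneE[_ Op]; apply: nOp; rewrite (iffLR (interior_id _) oOm).
have clBp : closure Bt (projectivize p).
  have : [set projectivize p] (projectivize p) by [].
  by rewrite -pfp => -[].
have GpC A : Gamma A -> ~ C (A *m p).
  move=> GA CAp; apply: nCp; rewrite -[p](mulKmx (Gu _ GA)).
  by apply: GC => //; exact: GV.
have Gclp A : Gamma A -> closure C (A *m p).
  move=> GA U /(continuous_mulmx (A := A)) /clCp[v [Cv Uv]].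
  by exists (A *m v); split => //; exact: GC.
(* The equation of the supporting hyperplane, with its sign chosen. It has no zero on C, since a
   zero would be a positive multiple of [p]. *)
have [psi [psip psiC psiker psiH]] : exists psi : 'rV[R]_n.+1,
    [/\ linform psi p = 0, forall v, C v -> 0 < linform psi v,
    forall v, closure C v -> linform psi v = 0 -> exists t, v = t *: p
    & forall v, linform psi v = 0 <-> linform psi0 v = 0].
  have psi0p : linform psi0 p = 0.
    apply/hyperplane_projectivize => //; rewrite -HE.
    have : [set projectivize p] (projectivize p) by [].
    by rewrite -Hq => -[].
  have ker v : closure C v -> linform psi0 v = 0 -> exists t, v = t *: p.
    move=> clv pv; have [->|v0] := eqVneq v 0; first by exists 0; rewrite scale0r.
    have : [set projectivize p] (projectivize v).
      rewrite -Hq; split; first by rewrite HE; exact/hyperplane_projectivize.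
      exact: closure_cone_lift clv v0.
    by move=> /(projectivize_eq v0 p0)[t _ ->]; exists t.
  have C_neq0 v : C v -> linform psi0 v != 0.
    move=> Cv; apply/eqP => pv; have [t vt] := ker _ (subset_closure Cv) pv.
    apply: nCp; have t0 : 0 < t.
      by rewrite -(pmulr_lgt0 _ phip) -linformZ -vt; case/coneE: Cv.
    have -> : p = t^-1 *: v by rewrite vt scalerA mulVf ?scale1r// gt_eqF.
    by apply: coneZ => //; rewrite invr_gt0.
  have [pos|neg] := linform_const_sign oC C_neq0; first by exists psi0.
  exists (- psi0); split => [|v /neg||v].
  - by rewrite linformNl psi0p oppr0.
  - by rewrite linformNl oppr_gt0.
  - by move=> v clv; rewrite linformNl => /eqP; rewrite oppr_eq0 => /eqP; exact: ker.
  - by rewrite linformNl; split => [/eqP|->]; rewrite ?oppr0// oppr_eq0 => /eqP.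
have [x Cx] := C0.
have psi_neq0 : psi != 0.
  by apply: contraTneq (psiC x Cx) => ->; rewrite /linform mul0mx mxE ltxx.
(* The projective fixed point gives A p = a p, and a >= 0 because [phi] is nonnegative on the
   closure of C. *)
have Sp A : S A -> A *m p = p.
  move=> SA; have [->|/eqP A1] := eqVneq A 1%:M; first by rewrite mul1mx.
  have [parA _] := Spar A SA A1; have GA := SG _ SA.
  have uA := Gu _ GA; have := fixq A SA; rewrite pact_projectivize//.
  move=> /(projectivize_eq (mulmx_neq0 uA p0) p0)[a a0 Ap].
  have phiC v : C v -> 0 * `|v| <= linform phi v by rewrite mul0r => /coneE[/ltW].
  have := linform_closure_ge phiC (Gclp A GA).
  rewrite mul0r Ap linformZ pmulr_lge0// => a_ge0.
  by rewrite (parabolic_col_eigenvalue parA p0 Ap a_ge0) scale1r.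
(* [A] preserves the kernel of [psi], hence multiplies [psi] by the ratio of its values at A x and
   x, both positive. *)
have Spsi A : S A -> psi *m A = psi.
  move=> SA; have [->|/eqP A1] := eqVneq A 1%:M; first by rewrite mulmx1.
  have [parA AH] := Spar A SA A1; have GA := SG _ SA; have uA := Gu _ GA.
  have px := psiC x Cx; have px0 := lt0r_neq0 px.
  pose a := linform psi (A *m x) / linform psi x.
  have kerA v : linform psi v = 0 -> linform psi (A *m v) = 0.
    have [->|v0] := eqVneq v 0; first by rewrite mulmx0.
    move=> pv; apply/psiH/hyperplane_projectivize; first exact: mulmx_neq0.
    rewrite -HE -AH; exists (projectivize v); last exact: pact_projectivize.
    by rewrite HE; apply/hyperplane_projectivize => //; exact/psiH.
  have psiA : psi *m A = a *: psi.
    apply: linform_eq => v; rewrite linformZl -linform_mul.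
    have /kerA : linform psi (v - (linform psi v / linform psi x) *: x) = 0.
      by rewrite linformB linformZ divfK// subrr.
    rewrite mulmxBr -scalemxAr linformB linformZ => /eqP.
    by rewrite subr_eq0 /a => /eqP ->; field.
  have a0 : 0 <= a by rewrite divr_ge0// ltW//; apply: psiC => //; exact: GC.
  by rewrite psiA (parabolic_row_eigenvalue parA psi_neq0 psiA a0) scale1r.
have Sdet A : S A -> `|\det A| = 1 by move=> /SG/Gdet.
have SC A v : S A -> C v -> C (A *m v) by move=> /SG; exact: GC.
have [clDp cob1 cob2] := cusp_cobounded Ophi oC oD D0 DC c0 Cphi Sgrp Sdisc Sdet SC SD
  Sp Spsi p0 phip clCp nCp psip psiC psiker PO Zk BO connB clBp.
have psiD v : D v -> 0 < linform psi v by move=> /DC/psiC.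
have SV A : S A -> S (invmx A) by have [_ _ _] := Sgrp; apply.
have GV' A : Gamma A -> A \in unitmx /\ Gamma (invmx A).
  by move=> GA; split; [exact: Gu|exact: GV].
have Gpsi A : Gamma A -> A *m p = p \/ 0 < linform psi (A *m p).
  move=> GA; have clA := Gclp A GA.
  have psi_ge0 v : C v -> 0 * `|v| <= linform psi v by rewrite mul0r => /psiC/ltW.
  have := linform_closure_ge psi_ge0 clA; rewrite mul0r le_eqVlt.
  move=> /predU1P[/esym pA|]; last by right.
  (* Here A p = t p with t > 0. A point of [D] pushed far enough up along [p] is mapped by [A] far
     up along [p], hence into [D], so [A] stabilizes [Bt]. *)
  left; have [t At] := psiker _ clA pA.
  have phi_ge := linform_closure_ge Cphi clA.
  have t0 : 0 < t.
    rewrite -(pmulr_lgt0 _ phip) -linformZ -At (lt_le_trans _ phi_ge)//.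
    by rewrite mulr_gt0// normr_gt0 mulmx_neq0// Gu.
  have [y Dy] := D0; have [_ _ DZ] := oD.
  have pAy := psiC _ (GC _ _ GA (DC _ Dy)); set l := linform psi (A *m y) in pAy.
  have [|s Ds] := cusp_cone_full oD SD psiD D0 cob2 (v := l^-1 *: (A *m y)).
    by rewrite linformZ mulVf// gt_eqF.
  have {}Ds : D (A *m y + (l * s) *: p).
    have := DZ _ _ pAy Ds.
    by rewrite scalerDr !scalerA mulfV ?scale1r// gt_eqF.
  pose r := Num.max 0 (l * s / t).
  apply/Sp/(GD A (y + r *: p)) => //.
    by apply: cone_add_ge0 => //; rewrite le_max lexx.
  rewrite mulmxDr -scalemxAr At scalerA; apply: cusp_cone_ge Ds => //.
  by rewrite -ler_pdivrMr// le_max lexx orbT.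
have [d d0 gap] := parabolic_orbit_gap oC oD DC c0 Cphi GM GV' Gdet GC SG SV Sp Spsi SD
  D0 p0 clDp psip psiC cob1 cob2 GD GpC Gpsi.
move=> _ [A GA <-]; split; first by apply: mem_set; exists A.
have uA := Gu _ GA.
(* If E p lies in this neighbourhood of A p, then the gap applied to A^-1 E gives A^-1 E p = p, that
   is, E p = A p. *)
exists [set v | linform psi (invmx A *m v) < d].
  apply: open_nbhs_nbhs; split; last by rewrite /= mulKmx// psip.
  apply: (@open_comp _ _ (fun v => linform psi (invmx A *m v)) [set t | t < d]).
    move=> v _; rewrite (_ : (fun v => _) = linform (psi *m invmx A)).
      exact: continuous_linform.
    by apply/funext => w; rewrite linform_mul.
  exact: open_lt.
apply/seteqP; split => [v [small [E GE Ev]]|_ ->] /=; last first.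
  by split; [rewrite mulKmx// psip|exists A].
rewrite -{v}Ev in small *.
have GAE : Gamma (invmx A *m E) by apply: GM => //; exact: GV.
have [e|] := gap _ GAE; first by rewrite -[in RHS]e -mulmxA mulKVmx.
by rewrite -mulmxA leNgt small.
Qed.
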